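(* Fix an integer $B\ge2$. Then: (i) For $n\ge3$, the maximum of $\Lambda_B$ over kernel-free MLS on $[n]$ is $$M_n^{*}(B)=(B+1)^{n-1}-B^{n-1}+B,$$ attained, for $n\ge5$, exactly by the $n$ one-flip stars $\mathcal F_a^{*}$, $a\in[n]$; for $n=4$ by the four one-flip stars together with the four triangle systems $\mathcal T_C=\binom{C}{2}\cup\binom{[4]}{3}\cup\{[4]\}$, $C\in\binom{[4]}{3}$, all eight of layer profile $(f_0,f_1,f_2,f_3,f_4)=(0,0,3,4,1)$ and hence with $\Lambda_B$-value $3B^{2}+4B+1=M_4^{*}(B)$; and for $n=3$ the three $\mathcal F_a^{*}$ coincide. For $B=2$ the value is $3^{n-1}-2^{n-1}+2$. (ii) For $n\ge5$, every kernel-free MLS $M$ on $[n]$ other than the $\mathcal F_a^{*}$, $a\in[n]$, satisfies $$\Lambda_B(M)\le M_n^{*}(B)-\bigl(B^{\,n-2}-B^{2}\bigr),$$ with equality precisely for the systems $U_{a,D}$ with $a\in[n]$, $D\subseteq[n]\setminus\{a\}$, $|D|=n-2$, and, when $n=5$ only, additionally for the $10$ balls $\mathcal A_T=\{S\subseteq[5]:|S\cap T|\ge2\}$, $T\in\binom{[5]}{3}$; in particular the equality set is independent of $B$. For $B=2$ the gap is $2^{n-2}-4$. (iii) As $n\to\infty$, $$R^{(B)}(n)=\bigl(1-B^{-B}+o(1)\bigr)\,n\cdot B^{\,M_n^{*}(B)},$$ $$\log_B\frac{Z_\cap^{(B)}(n)}{R^{(B)}(n)}=B^{\,n-1}-B+\log_B\frac{B^{B}}{B^{B}-1}+o(1);$$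 for $B=2$ the constants are $1-2^{-2}=\tfrac34$ and $\log_2\tfrac43$.
   Context: $[n]=\{1,\dots,n\}$; $V_n$ is the set of nonempty subsets of $[n]$; $\binom{X}{k}$ is the set of $k$-element subsets of $X$. A family $\mathcal F\subseteq V_n$ is intersecting if $A\cap B'\ne\varnothing$ for all $A,B'\in\mathcal F$ (the empty family is intersecting). Its kernel is $\ker\mathcal F=\bigcap_{S\in\mathcal F}S$, with $\ker\varnothing=[n]$; it is kernel-free if $\ker\mathcal F=\varnothing$. A maximal linked system (MLS) on $[n]$ is an inclusion-maximal intersecting family $\mathcal F\subseteq V_n$. Layer profile: $f_k=|\{S\in\mathcal F:|S|=k\}|$. For the integer $B\ge2$: $\Lambda_B(\mathcal F)=\sum_{S\in\mathcal F}B^{\,n-|S|}$, and $w_B(S)=B^{\,B^{\,n-|S|}}-1$ for $S\in V_n$. $Z_\cap^{(B)}(n)=\sum_{\mathcal F}\prod_{S\in\mathcal F}w_B(S)$ over intersecting families $\mathcal F\subseteq V_n$ with $\ker\mathcal F\neq\varnothing$ (empty product $=1$), and $R^{(B)}(n)$ is the same sum over intersecting families with $\ker\mathcal F=\varnothing$. $\mathrm{Star}(a)=\{S\in V_n:a\in S\}$ and $\mathcal F_a^{*}=(\mathrm{Star}(a)\setminus\{\{a\}\})\cup\{[n]\setminus\{a\}\}$. For $i\in[n]$ and $D\subseteq[n]\setminus\{i\}$ with $|D|\ge2$, $U_{i,D}=\{S\subseteq[n]: i\in S,\ S\cap D\ne\varnothing\}\cup\{S\subseteq[n]:i\notin S,\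 D\subseteq S\}$. *)

(* Defs.v *)
From mathcomp Require Import all_boot all_order all_algebra.
From mathcomp Require Import all_classical all_reals all_analysis.

Set Implicit Arguments.
Unset Strict Implicit.
Unset Printing Implicit Defensive.

Import Order.TTheory GRing.Theory Num.Theory.

(* The ground set [n] is 'I_n, so its elements are numbered from 0. *)

Definition V (n : nat) : {set {set 'I_n}} := [set S : {set 'I_n} | S != finset.set0].

Definition intersecting (n : nat) (F : {set {set 'I_n}}) : bool :=
  (F \subset V n) &&
  [forall A in F, forall C in F, A :&: C != finset.set0].

(* The intersection over the empty family is the whole of 'I_n. *)
Definition ker (n : nat) (F : {set {set 'I_n}}) : {set 'I_n} :=
  (\bigcap_(S in F) S)%SET.

Definition kernel_free (n : nat) (F : {set {set 'I_n}}) : bool :=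
  ker F == finset.set0.

Definition MLS (n : nat) (F : {set {set 'I_n}}) : bool :=
  maxset (@intersecting n) F.

Definition kf_MLS (n : nat) (F : {set {set 'I_n}}) : bool :=
  MLS F && kernel_free F.

Definition layer (n : nat) (F : {set {set 'I_n}}) (k : nat) : nat :=
  #|[set S in F | #|S| == k]|.

Definition Lambda (B n : nat) (F : {set {set 'I_n}}) : nat :=
  (\sum_(S in F) B ^ (n - #|S|))%N.

Definition w (B n : nat) (S : {set 'I_n}) : nat :=
  (B ^ (B ^ (n - #|S|)) - 1)%N.

Definition Zcap (B n : nat) : nat :=
  (\sum_(F : {set {set 'I_n}} | intersecting F && ~~ kernel_free F)
     \prod_(S in F) w B S)%N.

Definition Rfree (B n : nat) : nat :=
  (\sum_(F : {set {set 'I_n}} | intersecting F && kernel_free F)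
     \prod_(S in F) w B S)%N.

Definition Star (n : nat) (a : 'I_n) : {set {set 'I_n}} :=
  [set S in V n | a \in S].

Definition flip (n : nat) (a : 'I_n) : {set {set 'I_n}} :=
  (Star a :\ [set a]) :|: [set [set~ a]].

Definition one_flips (n : nat) : {set {set {set 'I_n}}} :=
  [set flip a | a : 'I_n].

Definition triangle (C : {set 'I_4}) : {set {set 'I_4}} :=
  [set S : {set 'I_4} | (S \subset C) && (#|S| == 2)]
    :|: [set S : {set 'I_4} | #|S| == 3] :|: [set [set: 'I_4]].

Definition triangles : {set {set {set 'I_4}}} :=
  [set triangle C | C : {set 'I_4} & #|C| == 3].

Definition U (n : nat) (i : 'I_n) (D : {set 'I_n}) : {set {set 'I_n}} :=
  [set S : {set 'I_n} | (i \in S) && (S :&: D != finset.set0)]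
    :|: [set S : {set 'I_n} | (i \notin S) && (D \subset S)].

Definition U_systems (n : nat) : {set {set {set 'I_n}}} :=
  [set F | [exists a : 'I_n, exists D : {set 'I_n},
     [&& D \subset [set~ a], #|D| == (n - 2)%N & F == U a D]]].

Definition ball (T : {set 'I_5}) : {set {set 'I_5}} :=
  [set S : {set 'I_5} | 2 <= #|S :&: T|].

Definition balls : {set {set {set 'I_5}}} :=
  [set ball T | T : {set 'I_5} & #|T| == 3].

Definition Mstar (B n : nat) : nat :=
  ((B + 1) ^ (n - 1) - B ^ (n - 1) + B)%N.

Definition gap (B n : nat) : nat := (B ^ (n - 2) - B ^ 2)%N.

Definition maximizers (B n : nat) : {set {set {set 'I_n}}} :=
  [set F | kf_MLS F &
     [forall G : {set {set 'I_n}}, kf_MLS G ==> (Lambda B G <= Lambda B F)%N]].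

(* For 2 <= B and 5 <= n neither subtraction truncates. *)
Definition second_extremal (B n : nat) : {set {set {set 'I_n}}} :=
  [set F | [&& kf_MLS F, F \notin one_flips n
             & Lambda B F == (Mstar B n - gap B n)%N]].

Definition logb (R : realType) (b x : R) : R := (ln x / ln b)%R.

(* Main.v *)
(** For a maximal linked system M exactly one of S and ~: S lies in M, so
    Lambda is an increasing function of the layer sizes f_k with 2k < n.  A
    kernel-free M has f_0 = f_1 = 0, and for 2 <= k < n/2 the Erdos-Ko-Rado
    theorem bounds f_k by the size of the k-th layer of a star, which is also
    that of a one-flip star.  Hence one-flip stars are extremal, and for n >= 5
    a deficit d of f_2 costs at least d (B^(n-2) - B^2).  The 2-sets of M form
    a star or a triangle; n - 1 or n - 2 of them with a common point a force
    M = U a D for D the set of their other ends, and a triangle C forces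
    M = {S : |S :&: C| >= 2}.

    The weights satisfy 1 + w S = B^(B^(n-|S|)), so the subfamilies of M have
    total weight B^(Lambda M).  The kernel-free families lie in one-flip stars,
    with overlaps bounded by inclusion-exclusion, or in one of the other
    systems, each of weight at most B^(Mstar - gap).  There are at most
    168^(2^(n-5)) of those: a system is determined by a monotone Boolean
    function of n - 1 variables, and 168 is the number of such functions of 4
    variables.  This count is absorbed by the gap because 168 < 2^8. *)

Require Import Defs.
From mathcomp Require Import fingroup perm.
From mathcomp Require Import all_boot all_order all_algebra.
From mathcomp Require Import all_classical all_reals all_analysis.
From mathcomp Require Import zify ring lra.
Import Order.TTheory GRing.Theory Num.Theory.
Import numFieldNormedType.Exports.

Section Combinatorics.
(* Restores the finite-set meaning of names such as [set0] and [setIC], which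
   the classical-set library shadows. *)
Import mathcomp.boot.fintype mathcomp.boot.finset.
Set Implicit Arguments.
Unset Strict Implicit.

(** * Maximal linked systems *)

Lemma intersectingP n (F : {set {set 'I_n}}) :
  reflect (forall A C, A \in F -> C \in F -> A :&: C != set0) (intersecting F).
Proof.
apply: (iffP andP) => [[_ /forallP H] A C AF CF|H].
  by move: (H A); rewrite AF => /forallP /(_ C); rewrite CF.
split.
  apply/subsetP => S SF; rewrite inE.
  by have := H S S SF SF; rewrite setIid.
apply/forallP => A; apply/implyP => AF; apply/forallP => C; apply/implyP.
exact: H.
Qed.

Lemma intersecting_sub n (F G : {set {set 'I_n}}) :
  F \subset G -> intersecting G -> intersecting F.
Proof.
move=> /subsetP FG /intersectingP H; apply/intersectingP => A C AF CF.
by apply: H; apply: FG.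
Qed.

Lemma kernel_freeP n (F : {set {set 'I_n}}) :
  reflect (forall a, exists2 S, S \in F & a \notin S) (kernel_free F).
Proof.
apply: (iffP eqP) => [H a|H].
  have : a \notin ker F by rewrite H inE.
  rewrite /ker => /bigcapP aF; apply: contrapT => nS; apply: aF => S SF.
  by apply/negPn/negP => aS; apply: nS; exists S.
apply/setP => a; rewrite inE; apply/negP => /bigcapP aF.
by have [S SF /negP] := H a; apply; apply: aF.
Qed.

Lemma kernel_free_sub n (F G : {set {set 'I_n}}) :
  F \subset G -> kernel_free F -> kernel_free G.
Proof.
move=> /subsetP FG /kernel_freeP H; apply/kernel_freeP => a.
by have [S SF aS] := H a; exists S => //; apply: FG.
Qed.

Lemma MLS_intersecting n (M : {set {set 'I_n}}) : MLS M -> intersecting M.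
Proof. exact: maxsetp. Qed.

Lemma MLS_eq n (M G : {set {set 'I_n}}) :
  MLS M -> intersecting G -> M \subset G -> M = G.
Proof. by move=> HM HG MG; rewrite (maxsetsup HM HG MG). Qed.

(** A set outside such an [F] is disjoint from its own complement, which lies in [F], so nothing can
    be added. *)
Lemma MLS_of_compl n (F : {set {set 'I_n}}) : intersecting F ->
  (forall S, (S \in F) || (~: S \in F)) -> MLS F.
Proof.
move=> HF H; apply/maxsetP; split => // G /intersectingP HG FG.
apply/eqP; rewrite eqEsubset FG andbT; apply/subsetP => S SG.
have /orP[//|/(subsetP FG) CG] := H S.
by have := HG _ _ SG CG; rewrite setICr eqxx.
Qed.

Lemma MLS_extend n (M : {set {set 'I_n}}) S : MLS M -> S != set0 ->
  (forall A, A \in M -> A :&: S != set0) -> S \in M.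
Proof.
move=> HM S0 HS; have -> : M = S |: M; last by rewrite !inE eqxx.
apply: MLS_eq => //; last exact: subsetUr.
apply/intersectingP => A C; rewrite !inE => /predU1P[->|AM] /predU1P[->|CM].
- by rewrite setIid.
- by rewrite setIC HS.
- by rewrite HS.
- by move/intersectingP: (MLS_intersecting HM) => H; apply: H.
Qed.

Lemma MLS_neq0 n (M : {set {set 'I_n}}) S : MLS M -> S \in M -> S != set0.
Proof.
by move=> /MLS_intersecting /intersectingP H SM; have := H S S SM SM; rewrite setIid.
Qed.

Lemma MLS_up n (M : {set {set 'I_n}}) (S T : {set 'I_n}) : MLS M ->
  S \in M -> S \subset T -> T \in M.
Proof.
move=> HM SM ST; apply: MLS_extend => //.
  by apply: contraTneq ST => ->; rewrite subset0 (MLS_neq0 HM).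
move=> A AM; have /set0Pn[x /setIP[xA xS]] : A :&: S != set0.
  by move/intersectingP: (MLS_intersecting HM) => H; apply: H.
by apply/set0Pn; exists x; rewrite inE xA (subsetP ST).
Qed.

(** If a nonempty [S] is not in [M], maximality gives a member disjoint from [S]; it lies inside
    [~: S], and [M] is closed upwards. For empty [S] the complement is the whole ground set,
    nonempty because [0 < n]. *)
Lemma MLS_setC n (M : {set {set 'I_n}}) (S : {set 'I_n}) : (0 < n)%N -> MLS M ->
  (~: S \in M) = (S \notin M).
Proof.
move=> n0 HM; apply/idP/idP => [CM|SM].
  apply/negP => SM; move/intersectingP: (MLS_intersecting HM) => H.
  by have := H _ _ SM CM; rewrite setICr eqxx.
have [->|S0] := eqVneq S set0.
  rewrite setC0; apply: MLS_extend => // [|A /(MLS_neq0 HM)]; last by rewrite setIT.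
  by apply/set0Pn; exists (Ordinal n0); rewrite inE.
have [A AM AS] : exists2 A, A \in M & A :&: S = set0.
  apply: contrapT => H; case/negP: SM; apply: MLS_extend => // A AM.
  by apply/eqP => AS; apply: H; exists A.
by apply: MLS_up AM _; rewrite // -disjoints_subset -setI_eq0 AS.
Qed.

Lemma kf_MLS_set1 n (M : {set {set 'I_n}}) (a : 'I_n) : kf_MLS M -> [set a] \notin M.
Proof.
case/andP => HM /kernel_freeP /(_ a)[S SM aS]; apply/negP => aM.
move/intersectingP: (MLS_intersecting HM) => /(_ _ _ aM SM) /set0Pn[x].
by rewrite !inE => /andP[/eqP->]; apply/negP.
Qed.


(** * The systems [U i D], one-flip stars and balls *)

Lemma in_U n (i : 'I_n) (D S : {set 'I_n}) : S \in U i D =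
  if i \in S then S :&: D != set0 else D \subset S.
Proof. by rewrite !inE; case: (i \in S); rewrite ?orbF. Qed.

Lemma U_intersecting n (i : 'I_n) (D : {set 'I_n}) : D != set0 -> intersecting (U i D).
Proof.
move=> /set0Pn[d dD]; apply/intersectingP => A C; rewrite !in_U.
case: ifP => iA; case: ifP => iC.
- by move=> _ _; apply/set0Pn; exists i; rewrite inE iA.
- move=> /set0Pn[x /setIP[xA xD]] /subsetP DC.
  by apply/set0Pn; exists x; rewrite inE xA DC.
- move=> /subsetP DA /set0Pn[x /setIP[xC xD]].
  by apply/set0Pn; exists x; rewrite inE xC DA.
- by move=> /subsetP DA /subsetP DC; apply/set0Pn; exists d; rewrite inE DA ?DC.
Qed.

(** The two membership conditions are exchanged by complement and negation, which gives maximality.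
    For the kernel, [D] misses [i], and a pair [[set i; x]] with [x] in [D :\ b] misses any other
    [b]; such an [x] exists since [2 <= #|D|]. *)
Lemma U_kf_MLS n (i : 'I_n) (D : {set 'I_n}) :
  D \subset [set~ i] -> (2 <= #|D|)%N -> kf_MLS (U i D).
Proof.
move=> Di D2; have D0 : D != set0 by rewrite -card_gt0 ltnW.
have iD : i \notin D by apply/negP => /(subsetP Di); rewrite !inE eqxx.
apply/andP; split.
  apply: MLS_of_compl => [|S]; first exact: U_intersecting.
  rewrite !in_U inE; case: ifP => iS /=.
    by rewrite -disjoints_subset disjoint_sym -setI_eq0 orNb.
  by rewrite setIC -setDE setD_eq0 orbN.
apply/kernel_freeP => b; have [->|bi] := eqVneq b i.
  by exists D => //; rewrite in_U (negbTE iD).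
have /card_gt0P[x] : (0 < #|D :\ b|)%N.
  by have := cardsD1 b D; case: (b \in D); lia.
rewrite !inE => /andP[xb xD]; exists [set i; x].
  rewrite in_U !inE eqxx; apply/set0Pn; exists x.
  by rewrite !inE eqxx xD orbT.
by rewrite !inE negb_or bi eq_sym.
Qed.

(** A set through [a] is disjoint from [[set~ a]] only if it is [[set a]], and [[set~ a]] is the
    only set avoiding [a] that contains [[set~ a]]. *)
Lemma flipE n (a : 'I_n) : flip a = U a [set~ a].
Proof.
apply/setP => S; rewrite in_U !inE; case: ifP => aS.
  have -> : (S == [set~ a]) = false.
    by apply/negbTE; apply: contraTneq aS => ->; rewrite !inE eqxx.
  have /negbTE S0 : S != set0 by apply/set0Pn; exists a.
  by rewrite orbF andbT -setDE setD_eq0 subset1 S0 orbF andbT.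
rewrite !andbF /= eqEsubset; apply/andb_idl => _.
by apply/subsetP => x xS; rewrite !inE; apply: contraTneq xS => ->; rewrite aS.
Qed.

Lemma cardC1_ord n (a : 'I_n) : #|[set~ a]| = (n - 1)%N.
Proof. by rewrite cardsC1 card_ord subn1. Qed.

Lemma flip_kf_MLS n (a : 'I_n) : (3 <= n)%N -> kf_MLS (flip a).
Proof. by move=> n3; rewrite flipE U_kf_MLS // cardC1_ord; lia. Qed.

Lemma in_flip n (a : 'I_n) (S : {set 'I_n}) : S \in flip a =
  if a \in S then S != [set a] else S == [set~ a].
Proof.
rewrite !inE; case: ifP => aS; last by rewrite !andbF.
have -> : S != set0 by apply/set0Pn; exists a.
rewrite !andbT; case: (eqVneq S [set~ a]) aS => [->|]; last by rewrite orbF.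
by rewrite !inE eqxx.
Qed.

Definition nbh n (M : {set {set 'I_n}}) (a : 'I_n) : {set 'I_n} :=
  [set x | (x != a) && ([set a; x] \in M)].

Lemma nbh_sub n (M : {set {set 'I_n}}) a : nbh M a \subset [set~ a].
Proof. by apply/subsetP => x; rewrite !inE => /andP[]. Qed.

(** By maximality of [M] the inclusion in [U] suffices. A member avoiding [a] must meet each pair
    [[set a; x]] at [x]. A member through [a] disjoint from [nbh M a] has at most one further point,
    hence is [[set a]] or a pair whose other end would belong to [nbh M a]. *)
Lemma MLS_eq_U n (M : {set {set 'I_n}}) a : kf_MLS M -> nbh M a != set0 ->
  (n - 2 <= #|nbh M a|)%N -> M = U a (nbh M a).
Proof.
move=> kfM D0 Dn; have /andP[HM _] := kfM.
apply: MLS_eq; rewrite // ?U_intersecting //; apply/subsetP => S SM.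
rewrite in_U; case: ifPn => aS; last first.
  apply/subsetP => x; rewrite inE => /andP[xa axM].
  move/intersectingP: (MLS_intersecting HM) => /(_ _ _ SM axM) /set0Pn[y].
  rewrite !inE => /andP[yS /orP[]/eqP E]; subst y => //.
  by rewrite yS in aS.
apply/negP => /eqP SD.
have : (#|S :\ a| <= 1)%N.
  have SDa : S :\ a \subset ~: (a |: nbh M a).
    apply/subsetP => x; rewrite in_setD1 => /andP[xa xS]; rewrite in_setC in_setU1 negb_or xa /=.
    apply/negP => xD; have : x \in S :&: nbh M a by rewrite in_setI xS.
    by rewrite SD inE.
  have := subset_leq_card SDa; have := cardsC (a |: nbh M a).
  rewrite cardsU1 card_ord.
  have -> /= : a \notin nbh M a by rewrite inE eqxx.
  by move: Dn; set c := #|~: _|; set d := #|nbh _ _|; set e := #|_|; lia.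
rewrite leq_eqVlt ltnS leqn0 cards_eq0 => /orP[/cards1P[x Sx]|/eqP Sa].
  have xa : x != a by have := set11 x; rewrite -Sx !inE => /andP[].
  have xS : x \in S by have := set11 x; rewrite -Sx !inE => /andP[].
  have SE : S = [set a; x] by rewrite -(setD1K aS) Sx.
  have : x \in S :&: nbh M a by rewrite !inE xS xa -SE.
  by rewrite SD inE.
have /negP[] := kf_MLS_set1 a kfM.
by have <- : S = [set a] by rewrite -(setD1K aS) Sa setU0.
Qed.

(** Two subsets of size at least two of a three-point set meet, and exactly one of [S] and [~: S]
    has two points in [T]. *)
Lemma ball_kf_MLS n (T : {set 'I_n}) : #|T| = 3 ->
  kf_MLS [set S : {set 'I_n} | 2 <= #|S :&: T|].
Proof.
move=> T3; apply/andP; split.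
  apply: MLS_of_compl.
    apply/intersectingP => A C; rewrite !inE => A2 C2; apply/negP => /eqP AC0.
    have := subset_leq_card (_ : (A :&: T) :|: (C :&: T) \subset T).
    rewrite cardsU setIACA AC0 set0I cards0 T3 -setIUl subsetIr => /(_ isT).
    lia.
  move=> S; rewrite !inE.
  by have := cardsID S T; rewrite setDE ![T :&: _]setIC T3; lia.
apply/kernel_freeP => a; exists (T :\ a); last by rewrite !inE eqxx.
rewrite inE; have -> : (T :\ a) :&: T = T :\ a by apply/setIidPl/subsetDl.
by have := cardsD1 a T; rewrite T3; case: (a \in T); lia.
Qed.

(** A member meeting [C] at most in one point [x] would be disjoint from the pair [C :\ x], which is
    in [M]. *)
Lemma MLS_eq_ball n (M : {set {set 'I_n}}) (C : {set 'I_n}) : kf_MLS M ->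
  #|C| = 3 -> (forall S : {set 'I_n}, S \subset C -> #|S| = 2 -> S \in M) ->
  M = [set S : {set 'I_n} | 2 <= #|S :&: C|].
Proof.
move=> /andP[HM _] C3 H; apply: MLS_eq => //.
  by have /andP[/MLS_intersecting] := ball_kf_MLS C3.
apply/subsetP => S SM; rewrite inE leqNgt; apply/negP => SC.
have /exists_inP : [exists x in C, S :&: C \subset [set x]].
  have /card_gt0P[c cC] : (0 < #|C|)%N by rewrite C3.
  move: SC; rewrite ltnS leq_eqVlt ltnS leqn0 cards_eq0 => /orP[/cards1P[x Sx]|/eqP->].
    apply/exists_inP; exists x; last by rewrite Sx.
    by have := set11 x; rewrite -Sx inE => /andP[].
  by apply/exists_inP; exists c => //; rewrite sub0set.
case=> x xC /subsetP Sx.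
have CM : C :\ x \in M.
  apply: H; first exact: subsetDl.
  by have := cardsD1 x C; rewrite xC C3; lia.
move/intersectingP: (MLS_intersecting HM) => /(_ _ _ SM CM) /set0Pn[y].
rewrite !inE => /and3P[yS yx yC].
by have := Sx y; rewrite !inE yS yC (negbTE yx) => /(_ isT).
Qed.

(** * The Erdos-Ko-Rado theorem *)

(** Induction on the size of [S :\: T]: transposing a point of [S :\: T] with one of [T :\: S]
    decreases it. *)
Lemma perm_transitive (X : finType) (S T : {set X}) : #|S| = #|T| ->
  exists s : {perm X}, s @: S = T.
Proof.
have [m] := ubnP #|S :\: T|; elim: m => // m IH in S T *; rewrite ltnS => Sm ST.
have [SsubT|] := boolP (S \subset T).
  exists 1%g; have -> : (1%g : {perm X}) @: S = S.
    by rewrite -[RHS]imset_id; apply: eq_imset => x; rewrite perm1.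
  by apply/eqP; rewrite eqEcard SsubT ST leqnn.
rewrite -setD_eq0 => /set0Pn[x xST].
have DD : #|S :\: T| = #|T :\: S|.
  by have := cardsID T S; have := cardsID S T; rewrite (setIC T) ST; lia.
have /card_gt0P[y yTS] : (0 < #|T :\: S|)%N by rewrite -DD; apply/card_gt0P; exists x.
move: xST yTS; rewrite !inE => /andP[xT xS] /andP[yS yT].
have tE : tperm x y @: S = y |: (S :\ x).
  apply/setP => z; rewrite -{1}(tpermK x y z) mem_imset; last exact: perm_inj.
  rewrite !inE; case: tpermP => [->|->|/eqP zx /eqP zy].
  - by rewrite (negbTE yS) eqxx orbF; apply/esym/negbTE; apply: contraNneq yS => <-.
  - by rewrite eqxx xS.
  - by rewrite zx (negbTE zy).
have [||s sT] := IH (tperm x y @: S) T.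
- rewrite tE (leq_trans _ Sm) //; apply: proper_card; apply/properP; split.
    apply/subsetP => z; rewrite !inE => /andP[zT /orP[/eqP zy|/andP[_ ->]]].
      by rewrite zy yT in zT.
    by rewrite zT.
  exists x; first by rewrite inE xT.
  by rewrite !inE eqxx /= orbF xT; apply: contraNneq yS => <-.
- by rewrite card_imset //; exact: perm_inj.
exists (tperm x y * s)%g; rewrite -sT -imset_comp; apply: eq_imset => z.
by rewrite permM.
Qed.

Definition perm_maps (X : finType) (S T : {set X}) : nat :=
  #|[set s : {perm X} | s @: S == T]|.

(** With [s] carrying [S2] to [S1] and [t] carrying [T1] to [T2], the map from [u] to [s * u * t]
    (products act from left to right) injects one set of permutations into the other. *)
Lemma perm_maps_const (X : finType) (S T S' T' : {set X}) :
  #|S| = #|S'| -> #|T| = #|T'| -> perm_maps S T = perm_maps S' T'.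
Proof.
have leq_maps (S1 T1 S2 T2 : {set X}) : #|S1| = #|S2| -> #|T1| = #|T2| ->
    (perm_maps S1 T1 <= perm_maps S2 T2)%N.
  move=> /esym /perm_transitive[s sE] /perm_transitive[t tE].
  have inj : injective (fun u : {perm X} => s * u * t)%g.
    by move=> u v /mulIg /mulgI.
  rewrite /perm_maps -(card_imset _ inj); apply: subset_leq_card.
  apply/subsetP => _ /imsetP[u uE ->]; move: uE; rewrite inE => /eqP uE.
  rewrite inE -tE -uE -sE -!imset_comp; apply/eqP/eq_imset => z.
  by rewrite !permM.
by move=> SS TT; apply/eqP; rewrite eqn_leq !leq_maps.
Qed.

Lemma perm_maps_gt0 (X : finType) (S T : {set X}) :
  #|S| = #|T| -> (0 < perm_maps S T)%N.
Proof.
by move=> /perm_transitive[s sE]; apply/card_gt0P; exists s; rewrite inE sE.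
Qed.

(* Comparing this count for F and for a layer of a star proves Erdos-Ko-Rado
   without evaluating either side. *)
Lemma sum_perm_maps (X I : finType) (k : nat) (A : I -> {set X}) (S0 : {set X})
  (F : {set {set X}}) : #|S0| = k -> (forall i, #|A i| = k) ->
  (forall S, S \in F -> #|S| = k) ->
  (\sum_(s : {perm X}) #|[set i | s @: A i \in F]|)%N =
  (#|I| * #|F| * perm_maps S0 S0)%N.
Proof.
move=> S0k Ak Fk.
transitivity (\sum_(i : I) \sum_(S in F) perm_maps (A i) S)%N.
  under [LHS]eq_bigr => s _ do rewrite -sum1dep_card big_mkcond /=.
  rewrite exchange_big; apply: eq_bigr => i _ /=.
  under [RHS]eq_bigr => S _ do rewrite /perm_maps -sum1dep_card big_mkcond /=.
  rewrite exchange_big; apply: eq_bigr => s _ /=.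
  rewrite -big_mkcondr /=; case: ifP => sF.
    rewrite (big_pred1 (s @: A i)) // => S /=.
    by rewrite (eq_sym S); case: eqP => [<-|]; rewrite ?sF ?andbF.
  by rewrite big_pred0 // => S; case: eqP => [<-|]; rewrite ?sF ?andbF.
under eq_bigr => i _.
  rewrite (eq_bigr (fun _ => perm_maps S0 S0)); last first.
    by move=> S SF; apply: perm_maps_const; rewrite S0k ?Ak ?Fk.
  rewrite sum_nat_const; over.
by rewrite sum_nat_const mulnA.
Qed.

(** Cyclic subtraction as a case distinction accessible to linear arithmetic. *)
Lemma val_subI n (x y : 'I_n.+1) :
  ((x - y)%R : nat) = if y <= x then x - y else (x + n.+1 - y)%N.
Proof.
have := ltn_ord x; have := ltn_ord y => yn xn; rewrite /= modnDmr; case: ifP => yx.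
  by rewrite addnBA 1?ltnW // addnC -addnBA // modnDl modn_small //; lia.
by rewrite addnBA 1?ltnW // modn_small //; lia.
Qed.

(** The subtraction is modulo [n.+1], so this is a run of [k] cyclically consecutive points starting
    at [i]. *)
Definition arc n k (i : 'I_n.+1) : {set 'I_n.+1} :=
  [set x | ((x - i)%R : nat) < k].

Lemma card_ord_lt n k : (k <= n)%N -> #|[set x : 'I_n | x < k]| = k.
Proof.
move=> kn; rewrite -sum1dep_card -(big_ord_widen n (fun=> 1%N)) //.
by rewrite sum1_card card_ord.
Qed.

Lemma card_arc n k (i : 'I_n.+1) : (k <= n.+1)%N -> #|arc k i| = k.
Proof.
move=> kn; rewrite -[RHS](card_ord_lt kn).
rewrite -(card_imset [set x : 'I_n.+1 | x < k] (@GRing.addIr _ i)).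
apply: eq_card => y; rewrite inE; apply/idP/imsetP => [yi|[x xk ->]].
  by exists (y - i)%R; rewrite ?inE ?GRing.subrK.
by rewrite inE in xk; rewrite GRing.addrK.
Qed.

Lemma card_arcs_through n k (x : 'I_n.+1) : (k <= n.+1)%N ->
  #|[set i | x \in arc k i]| = k.
Proof.
move=> kn; rewrite -[RHS](card_ord_lt kn).
have inj : injective (fun d : 'I_n.+1 => x - d)%R.
  by move=> a b /GRing.addrI /GRing.oppr_inj.
rewrite -(card_imset [set d : 'I_n.+1 | d < k] inj).
apply: eq_card => i; rewrite !inE; apply/idP/imsetP => [xi|[d dk ->]].
  by exists (x - i)%R; rewrite ?inE // GRing.opprB GRing.addrC GRing.subrK.
by rewrite inE in dk; rewrite GRing.opprB GRing.addrC GRing.subrK.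
Qed.

(** Katona's cycle argument: an arc meeting the one at [i0] starts fewer than [k] steps before or
    after [i0]. Apart from [i0] these starts split into [k - 1] pairs of disjoint arcs, and each
    pair contributes at most one start to [J]. *)
Lemma katona_cycle n k (J : {set 'I_n.+1}) : (0 < k)%N -> (k.*2 <= n.+1)%N ->
  {in J &, forall i j, arc k i :&: arc k j != set0} -> (#|J| <= k)%N.
Proof.
move=> k0 kn HJ; have [->|/set0Pn[i0 i0J]] := eqVneq J set0; first by rewrite cards0.
(* Going round the cycle, the arc at offset [e] would begin after the arc at [d] ends and end before
   that arc begins again, so the two could not meet. *)
have far i j : i \in J -> j \in J -> forall d e : nat,
    d = (i - i0)%R -> e = (j - i0)%R -> d + k <= e -> e + k <= n.+1 + d -> False.
  move=> iJ jJ d e; rewrite !val_subI => dE eE de ed.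
  have /set0Pn[x] := HJ i j iJ jJ; rewrite !inE !val_subI.
  have := ltn_ord x; have := ltn_ord i; have := ltn_ord j; have := ltn_ord i0.
  by move: dE eE; do !case: ifP; lia.
pose d (i : 'I_n.+1) : nat := (i - i0)%R.
have dn i : d i < n.+1 by exact: ltn_ord.
(* The arcs starting at offsets d and d - k from i0 are disjoint, so
   identifying these two offsets is injective on J. *)
pose g (i : 'I_n.+1) : 'I_n.+1 := inord (if d i < k then d i else d i + k - n.+1)%N.
have gE i : g i = (if d i < k then d i else d i + k - n.+1)%N :> nat.
  by rewrite inordK //; have := dn i; case: ifP; lia.
have kn1 : (k <= n.+1)%N by lia.
rewrite -[leqRHS](card_ord_lt kn1) -(@card_in_imset _ _ g J).
  apply: subset_leq_card; apply/subsetP => _ /imsetP[i iJ ->].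
  by rewrite inE gE; have := dn i; case: ifP; lia.
move=> i j iJ jJ gij; have {gij} : g i = g j :> nat by rewrite gij.
have d0 : d i0 = 0%N by rewrite /d GRing.subrr.
have := far _ _ iJ jJ _ _ erefl erefl; have := far _ _ jJ iJ _ _ erefl erefl.
have := far _ _ i0J iJ _ _ erefl erefl; have := far _ _ i0J jJ _ _ erefl erefl.
rewrite -!/(d _) !gE d0 => H1 H2 H3 H4 gij.
suff dij : d i = d j by apply: (@GRing.addIr _ (- i0)%R); apply: val_inj.
by have := dn i; have := dn j; move: H1 H2 H3 H4 gij; do !case: ifP; lia.
Qed.

(** Each permutation [s] sends at most [k] arcs into [F] by [katona_cycle], but exactly [k] into the
    star layer [G]. Summing over [s] yields the same positive multiple of [#|F|] and of [#|G|],
    which cancels. *)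
Theorem erdos_ko_rado n k (a : 'I_n) (F : {set {set 'I_n}}) :
  (0 < k)%N -> (k.*2 <= n)%N ->
  {in F &, forall S T, S :&: T != set0} -> (forall S, S \in F -> #|S| = k) ->
  (#|F| <= #|[set S : {set 'I_n} | (a \in S) && (#|S| == k)]|)%N.
Proof.
case: n a F => [|n] a F k0 kn HF Fk; first by case: a.
have kn1 : (k <= n.+1)%N by lia.
set G := [set S | _].
have Gk S : S \in G -> #|S| = k by rewrite inE => /andP[_ /eqP].
have A0 : #|arc k (ord0 : 'I_n.+1)| = k by exact: card_arc.
have Ak (i : 'I_n.+1) : #|arc k i| = k by exact: card_arc.
have := sum_perm_maps A0 Ak Fk; have := sum_perm_maps A0 Ak Gk.
set c := perm_maps _ _; have c0 : (0 < c)%N by exact: perm_maps_gt0.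
rewrite card_ord => SG SF.
suff: (n.+1 * #|F| * c <= n.+1 * #|G| * c)%N by rewrite leq_pmul2r // leq_pmul2l.
rewrite -SF -SG; apply: leq_sum => s _.
have -> : #|[set i | s @: arc k i \in G]| = k.
  (* The image of an arc contains [a] exactly when the arc contains the preimage of [a], and [k]
     arcs pass through a given point. *)
  rewrite -[RHS](@card_arcs_through n k ((s^-1)%g a)) //; apply: eq_card => i.
  rewrite !inE card_imset; last exact: perm_inj.
  by rewrite Ak eqxx andbT -{1}(permKV s a) mem_imset ?inE //; exact: perm_inj.
apply: katona_cycle => // i j; rewrite !inE => iF jF.
have := HF _ _ iF jF; rewrite -imsetI; last by move=> x y _ _; apply: perm_inj.
by apply: contraNneq => ->; rewrite imset0.
Qed.

(** * Layers and weights *)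

Lemma card_ordC n (S : {set 'I_n}) : #|~: S| = (n - #|S|)%N.
Proof. by rewrite cardsCs setCK card_ord. Qed.

Lemma Lambda_layers B n (F : {set {set 'I_n}}) :
  Lambda B F = (\sum_(k < n.+1) layer F k * B ^ (n - k))%N.
Proof.
rewrite /Lambda (partition_big (fun S : {set 'I_n} => inord #|S| : 'I_n.+1) predT) //=.
apply: eq_bigr => k _; rewrite /layer -sum_nat_const; apply: eq_big => [S|S].
  rewrite inE -val_eqE /= inordK // ltnS -[leqRHS](card_ord n); exact: max_card.
case/andP => _ /eqP <-; rewrite inordK // ltnS -[leqRHS](card_ord n); exact: max_card.
Qed.

(** Complementation matches the members of size [n - k] with the non-members of size [k]. *)
Lemma layer_setC n (M : {set {set 'I_n}}) k : (0 < n)%N -> (k <= n)%N -> MLS M ->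
  (layer M k + layer M (n - k))%N = #|[set S : {set 'I_n} | #|S| == k]|.
Proof.
move=> n0 kn HM; rewrite -(cardsID M [set S : {set 'I_n} | #|S| == k]).
congr (_ + _)%N; first by apply: eq_card => S; rewrite !inE andbC.
rewrite /layer -(card_imset _ (@setC_inj _)); apply: eq_card => S.
rewrite !inE; apply/imsetP/andP => [[T]|[SM /eqP Sk]].
  rewrite inE => /andP[TM /eqP Tk] ->; rewrite -MLS_setC // setCK TM card_ordC Tk.
  by rewrite subKn.
by exists (~: S); rewrite ?setCK // inE MLS_setC // SM card_ordC Sk /=.
Qed.

(** The terms at [k] and [n - k] are combined; a middle term with [k = n - k] vanishes, because
    there [d k = - d k]. *)
Lemma sum_antisym n (d c : nat -> int) :
  (forall k, (k <= n)%N -> d (n - k)%N = - d k)%R ->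
  (\sum_(k < n.+1) d k * c (n - k)%N =
   \sum_(k < n.+1 | (k.*2 < n)%N) d k * (c (n - k)%N - c k))%R.
Proof.
move=> dN; rewrite (bigID (fun k : 'I_n.+1 => (k.*2 < n)%N)) /=.
under [RHS]eq_bigr do rewrite GRing.mulrBr.
rewrite GRing.sumrB; congr (_ + _)%R; rewrite -GRing.sumrN.
rewrite (reindex_inj rev_ord_inj) /=.
rewrite (bigID (fun k : 'I_n.+1 => (k.*2 < n)%N)) /= [X in (_ + X)%R]big1; last first.
  move=> k /andP[k1 k2]; have := ltn_ord k => kn.
  have dk : d k = 0%R.
    have nk : (n - k)%N = k by lia.
    have : (d k = - d k)%R by rewrite -{1}nk dN //; lia.
    by lia.
  have -> : (n.+1 - k.+1)%N = k by lia.
  by rewrite dk GRing.mul0r.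
rewrite GRing.addr0; apply: eq_big => [k|k /andP[k1 k2]]; first by have := ltn_ord k; lia.
have kn := ltn_ord k; rewrite subSS dN; last by lia.
by rewrite subKn ?GRing.mulNr //; lia.
Qed.

(** By [layer_setC] the difference of the layer sizes changes sign under [k] to [n - k], so
    [sum_antisym] applies over the integers. The comparison of layers and [0 < B] make the truncated
    subtractions exact. *)
Lemma MLS_Lambda_sub B n (F G : {set {set 'I_n}}) : (0 < B)%N -> (0 < n)%N ->
  MLS F -> MLS G -> (forall k, (k.*2 < n)%N -> (layer F k <= layer G k)%N) ->
  Lambda B G = (Lambda B F +
    \sum_(k < n.+1 | (k.*2 < n)%N) (layer G k - layer F k) * (B ^ (n - k) - B ^ k))%N.
Proof.
move=> B0 n0 HF HG FG; apply/eqP; rewrite -(eqr_nat int) GRing.natrD; apply/eqP.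
apply/eqP; rewrite GRing.addrC -GRing.subr_eq; apply/eqP.
rewrite !Lambda_layers !GRing.natr_sum -GRing.sumrB.
pose d k : int := ((layer G k)%:R - (layer F k)%:R)%R.
transitivity (\sum_(k < n.+1) d k * (B ^ (n - k))%:R)%R.
  by apply: eq_bigr => k _; rewrite /d GRing.mulrBl !GRing.natrM.
rewrite (@sum_antisym n d (fun k => (B ^ k)%:R%R)); last first.
  move=> k kn; rewrite /d; have := layer_setC n0 kn HF; have := layer_setC n0 kn HG.
  by lia.
apply: eq_bigr => k kn; rewrite GRing.natrM !GRing.natrB ?FG //.
by apply: leq_pexp2l => //; lia.
Qed.

(** In this range the flip is invisible: it only exchanges a set of size 1 for one of size
    [n - 1]. *)
Lemma layer_flip n (a : 'I_n) k : (2 <= k)%N -> (k < n - 1)%N ->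
  layer (flip a) k = #|[set S : {set 'I_n} | (a \in S) && (#|S| == k)]|.
Proof.
move=> k2 kn; apply: eq_card => S; rewrite in_set [RHS]in_set in_flip; case: ifP => aS.
  by rewrite andb_idl // => /eqP Sk; apply: contraTneq k2 => SE; rewrite -Sk SE cards1.
by apply/negP => /andP[/eqP SE]; rewrite SE cardC1_ord; lia.
Qed.

Lemma kf_MLS_layer_le1 n (M : {set {set 'I_n}}) k : kf_MLS M -> (k <= 1)%N -> layer M k = 0%N.
Proof.
move=> HM k1; apply/eqP; rewrite cards_eq0; apply/eqP/setP => S; rewrite !inE.
apply/negP => /andP[SM /eqP Sk].
have /andP[HM1 _] := HM; have := MLS_neq0 HM1 SM; rewrite -card_gt0 => S0.
have /cards1P[x SE] : #|S| == 1%N by lia.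
by have := kf_MLS_set1 x HM; rewrite -SE SM.
Qed.

Lemma layer_le_flip n (M : {set {set 'I_n}}) (a : 'I_n) k : kf_MLS M ->
  (k.*2 < n)%N -> (layer M k <= layer (flip a) k)%N.
Proof.
move=> HM kn; have [k1|k2] := leqP k 1; first by rewrite (kf_MLS_layer_le1 HM k1).
rewrite layer_flip //; last by lia.
have /andP[/MLS_intersecting/intersectingP HM1 _] := HM.
have k0 : (0 < k)%N by lia.
apply: erdos_ko_rado => //; first by lia.
  by move=> S T; rewrite !inE => /andP[SM _] /andP[TM _]; apply: HM1.
by move=> S; rewrite inE => /andP[_ /eqP].
Qed.

Lemma Lambda_flip_sub B n (M : {set {set 'I_n}}) (a : 'I_n) : (0 < B)%N -> (3 <= n)%N ->
  kf_MLS M -> Lambda B (flip a) = (Lambda B M + \sum_(k < n.+1 | (k.*2 < n)%N)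
      (layer (flip a) k - layer M k) * (B ^ (n - k) - B ^ k))%N.
Proof.
move=> B0 n3 HM; have /andP[M1 _] := HM; have /andP[F1 _] := flip_kf_MLS a n3.
by apply: MLS_Lambda_sub => //; [lia|move=> k kn; apply: layer_le_flip].
Qed.

Lemma pairs_image n (a : 'I_n) (D : {set 'I_n}) : D \subset [set~ a] ->
  #|[set [set a; x] | x in D]| = #|D|.
Proof.
move=> /subsetP Da; apply: card_in_imset => x y xD yD /setP/(_ x).
rewrite !inE eqxx orbT => /esym/orP[/eqP xa|/eqP //].
by have := Da x xD; rewrite !inE xa eqxx.
Qed.

Lemma layer2_nbh n (M : {set {set 'I_n}}) (a : 'I_n) :
  (forall S, S \in M -> #|S| = 2 -> a \in S) -> layer M 2 = #|nbh M a|.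
Proof.
move=> Ha; rewrite -(pairs_image (nbh_sub M a)); apply: eq_card => S.
rewrite inE; apply/andP/imsetP => [[SM /eqP S2]|[x]].
  have aS := Ha S SM S2; have := cardsD1 a S; rewrite aS S2 => -[/esym/eqP/cards1P[x Sx]].
  have xa : x != a by have := set11 x; rewrite -Sx !inE => /andP[].
  have SE : S = [set a; x] by rewrite -(setD1K aS) Sx.
  by exists x => //; rewrite inE xa -SE.
by rewrite inE => /andP[xa axM] ->; split=> //; rewrite cards2 (eq_sym a) xa.
Qed.

Lemma layer2_flip n (a : 'I_n) : (4 <= n)%N -> layer (flip a) 2 = (n - 1)%N.
Proof.
move=> n4; rewrite (@layer2_nbh _ _ a) => [|S].
  rewrite -(cardC1_ord a); apply: eq_card => x.
  rewrite in_setC1 inE in_flip !inE eqxx /=; apply/andb_idr => xa.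
  by apply: contraNneq xa => /setP/(_ x); rewrite !inE eqxx orbT => /esym.
rewrite in_flip; case: ifP => // _ /eqP -> E; have := cardC1_ord a; rewrite E; lia.
Qed.

(** * Generating sums and the values of [Lambda] *)

Lemma sum_supersets B n (A : {set 'I_n}) :
  (\sum_(S : {set 'I_n} | A \subset S) B ^ (n - #|S|))%N = ((B + 1) ^ (n - #|A|))%N.
Proof.
have := @bigA_distr nat 0%N 1%N muln addn _ (fun i : 'I_n => 1%N)
  (fun i => if i \in A then 0%N else B).
(* Expanding the product, a point contributes 1 when in [S] and [B] when outside; the factor 0 on
   [A] kills every [S] that does not contain [A]. *)
move=> E; transitivity (\prod_(i : 'I_n) (1 + if i \in A then 0 else B))%N.
  rewrite E [RHS](bigID (fun S : {set 'I_n} => A \subset S)) /= [X in (_ + X)%N]big1.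
    rewrite addn0; apply: eq_bigr => S /subsetP AS.
    rewrite (bigID (mem S)) /= big1 ?mul1n => [|i ->//].
    rewrite (eq_bigr (fun=> B)) => [|i iS]; last first.
      by rewrite (negbTE iS) ifN //; apply: contra iS; apply: AS.
    rewrite prod_nat_const -card_ordC; congr (B ^ _)%N.
    by apply: eq_card => i; rewrite !inE.
  move=> S /subsetPn[x xA xS]; rewrite (bigD1 x) //= (negbTE xS) xA; exact: mul0n.
rewrite (bigID (mem A)) /= big1 ?mul1n => [|i ->//].
rewrite (eq_bigr (fun=> (B + 1)%N)) => [|i /negbTE->]; last by rewrite addnC.
rewrite prod_nat_const -card_ordC; congr (_ ^ _)%N.
by apply: eq_card => i; rewrite !inE.
Qed.

Lemma sum_subsets_prod (X : finType) (A : {set X}) (f : X -> nat) :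
  (\sum_(J : {set X} | J \subset A) \prod_(i in J) f i)%N = (\prod_(i in A) (f i + 1))%N.
Proof.
have := @bigA_distr nat 0%N 1%N muln addn _ (fun i => if i \in A then f i else 0%N) (fun=> 1%N).
move=> E; transitivity (\prod_i ((if i \in A then f i else 0) + 1))%N.
  rewrite E [RHS](bigID (fun S : {set X} => S \subset A)) /= [X in (_ + X)%N]big1.
    rewrite addn0; apply: eq_bigr => S /subsetP SA.
    rewrite [RHS](bigID (mem S)) /= [X in (_ * X)%N]big1 ?muln1 => [|i /negbTE->//].
    by apply: eq_bigr => i iS; rewrite iS SA.
  move=> S /subsetPn[x xS xA]; rewrite (bigD1 x) //= xS (negbTE xA); exact: mul0n.
rewrite (bigID (mem A)) /= [X in (_ * X)%N]big1 ?muln1 => [|i /negbTE->//].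
by apply: eq_bigr => i ->.
Qed.

Lemma w_add1 B n (S : {set 'I_n}) : (0 < B)%N -> (w B S + 1)%N = (B ^ (B ^ (n - #|S|)))%N.
Proof. by move=> B0; rewrite /w subnK // expn_gt0 B0. Qed.

Lemma sum_prod_w B n (M : {set {set 'I_n}}) : (0 < B)%N ->
  (\sum_(F : {set {set 'I_n}} | F \subset M) \prod_(S in F) w B S)%N = (B ^ Lambda B M)%N.
Proof.
move=> B0; rewrite sum_subsets_prod /Lambda expn_sum.
by apply: eq_bigr => S _; rewrite w_add1.
Qed.

Lemma Lambda_Star B n (a : 'I_n) : Lambda B (Star a) = ((B + 1) ^ (n - 1))%N.
Proof.
have := sum_supersets B [set a]; rewrite cards1 => <-; apply: eq_bigl => S.
rewrite !inE sub1set andb_idl // => aS; by apply/set0Pn; exists a.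
Qed.

(** The star loses [[set a]], which counts [B ^ (n - 1)], and gains [[set~ a]], which counts [B]. *)
Lemma Lambda_flip B n (a : 'I_n) : (2 <= n)%N -> (0 < B)%N -> Lambda B (flip a) = Mstar B n.
Proof.
move=> n2 B0; have aS : [set a] \in Star a.
  by rewrite !inE eqxx andbT; apply/set0Pn; exists a; rewrite inE.
have := Lambda_Star B a; rewrite /Lambda (big_setD1 _ aS) /= cards1 => E.
rewrite /Mstar -E addKn /Lambda.
rewrite (eq_bigl [predU (Star a :\ [set a]) & [set [set~ a]]]) => [|S]; last by rewrite !inE.
rewrite bigU /=; last by rewrite disjoint_sym disjoints1 !inE eqxx !andbF.
by rewrite big_set1 cardC1_ord subKn ?expn1 //; lia.
Qed.

(** * Extremal systems *)

(** Given pairs [[set a; b]] and [[set a; c]], a pair of [M] avoiding [a] must be [[set b; c]];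
    every pair meeting all three sides of this triangle lies inside it. *)
Lemma pairs_star_or_triangle n (M : {set {set 'I_n}}) :
  intersecting M -> (2 <= layer M 2)%N ->
  (exists a, forall S, S \in M -> #|S| = 2 -> a \in S) \/
  (exists2 C : {set 'I_n}, #|C| = 3 & forall S, S \in M -> #|S| = 2 -> S \subset C).
Proof.
move=> /intersectingP HM /card_gt1P[e [f []]].
rewrite !inE => /andP[eM e2] /andP[fM f2] ef.
have /set0Pn[a /setIP[ae af]] := HM _ _ eM fM.
have pairE (S : {set 'I_n}) : #|S| == 2 -> a \in S -> exists2 x, x != a & S = [set a; x].
  move=> S2 aS; have := cardsD1 a S; rewrite aS (eqP S2) => -[/esym/eqP/cards1P[x Sx]].
  exists x; first by have := set11 x; rewrite -Sx !inE => /andP[].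
  by rewrite -(setD1K aS) Sx.
have [b ba eE] := pairE e e2 ae; have [c ca fE] := pairE f f2 af.
have bc : b != c by apply: contraNneq ef => bc; rewrite eE fE bc.
have [/forallP all_a|] := boolP [forall S : {set 'I_n}, (S \in M) && (#|S| == 2) ==> (a \in S)].
  left; exists a => S SM S2; by have := all_a S; rewrite SM S2 eqxx.
rewrite negb_forall => /existsP[g]; rewrite negb_imply => /andP[/andP[gM g2] ag].
have bg : b \in g.
  have /set0Pn[x] := HM _ _ eM gM; rewrite eE !inE => /andP[/orP[]/eqP->] //.
  by rewrite (negbTE ag).
have cg : c \in g.
  have /set0Pn[x] := HM _ _ fM gM; rewrite fE !inE => /andP[/orP[]/eqP->] //.
  by rewrite (negbTE ag).
have gE : g = [set b; c].
  apply/eqP; rewrite eq_sym eqEcard (eqP g2) cards2 bc andbT.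
  by apply/subsetP => x; rewrite !inE => /orP[]/eqP->.
right; exists (a |: [set b; c]).
  by rewrite cardsU1 cards2 bc !inE negb_or eq_sym ba eq_sym ca.
move=> S SM S2; have := HM _ _ SM eM; have := HM _ _ SM fM; have := HM _ _ SM gM.
rewrite eE fE gE => /set0Pn[x] /setIP[xS xg] /set0Pn[y] /setIP[yS yf] /set0Pn[z] /setIP[zS ze].
have two u v : u \in S -> v \in S -> u != v -> u \in a |: [set b; c] ->
    v \in a |: [set b; c] -> S \subset a |: [set b; c].
  move=> uS vS uv uC vC; have <- : [set u; v] = S.
    apply/eqP; rewrite eqEcard S2 cards2 uv andbT.
    by apply/subsetP => t; rewrite !inE => /orP[]/eqP->.
  by apply/subsetP => t; rewrite in_set2 => /orP[]/eqP->.
(* The points [x], [y], [z] of [S] lie on the three sides. No vertex is on all three, so in each of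
   the eight cases two of them differ. *)
move: xS yS zS; move: xg yf ze; rewrite !in_set2 => /orP[]/eqP-> /orP[]/eqP-> /orP[]/eqP->
  => xS yS zS; try (by apply: (two a b); rewrite // ?inE ?eqxx ?orbT // eq_sym);
  try (by apply: (two a c); rewrite // ?inE ?eqxx ?orbT // eq_sym);
  by apply: (two b c); rewrite // ?inE ?eqxx ?orbT.
Qed.

(** In the triangle case there are only three pairs inside [C], so all of them belong to [M] and
    [MLS_eq_ball] determines [M]. *)
Lemma kf_MLS_pairs n (M : {set {set 'I_n}}) : kf_MLS M -> (3 <= layer M 2)%N ->
  (exists a, layer M 2 = #|nbh M a|) \/
  (layer M 2 = 3 /\
   exists2 C : {set 'I_n}, #|C| = 3 & M = [set S : {set 'I_n} | 2 <= #|S :&: C|]).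
Proof.
move=> HM M3; have /andP[/MLS_intersecting HI _] := HM.
have [[a Ha]|[C C3 HC]] := pairs_star_or_triangle HI (ltnW M3).
  by left; exists a; apply: layer2_nbh.
right; set L := [set S in M | #|S| == 2].
set P := [set S : {set 'I_n} | (S \subset C) && (#|S| == 2)].
have LP : L \subset P.
  by apply/subsetP => S; rewrite !inE => /andP[SM S2]; rewrite S2 HC //; apply/eqP.
have P3 : #|P| = 3 by rewrite cards_draws C3.
have L3 : layer M 2 = 3.
  by apply/eqP; rewrite eqn_leq M3 andbT -P3; apply: subset_leq_card.
have LPE : L = P by apply/eqP; rewrite eqEcard LP P3 -L3 leqnn.
split=> //; exists C => //; apply: MLS_eq_ball => // S SC S2.
have : S \in L by rewrite LPE inE SC S2.
by rewrite inE => /andP[].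
Qed.

Lemma eq_U_nbh n (M : {set {set 'I_n}}) a : (3 <= n)%N -> kf_MLS M ->
  (n - 2 <= #|nbh M a|)%N -> M = U a (nbh M a).
Proof.
move=> n3 HM Hn; apply: MLS_eq_U => //; rewrite -card_gt0; lia.
Qed.

Lemma nbh_full n (M : {set {set 'I_n}}) a : (3 <= n)%N -> kf_MLS M ->
  #|nbh M a| = (n - 1)%N -> M = flip a.
Proof.
move=> n3 HM Mn; rewrite (eq_U_nbh n3 HM (a := a)) ?Mn; last by lia.
rewrite flipE; congr (U a _); apply/eqP.
by rewrite eqEcard nbh_sub cardC1_ord Mn leqnn.
Qed.

Lemma Lambda_le_Mstar B n (M : {set {set 'I_n}}) : (0 < B)%N -> (3 <= n)%N ->
  kf_MLS M -> (Lambda B M <= Mstar B n)%N.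
Proof.
move=> B0 n3 HM; have n0 : (0 < n)%N by lia.
rewrite -(Lambda_flip (Ordinal n0) _ B0); last by lia.
by rewrite (Lambda_flip_sub (Ordinal n0) B0 n3 HM) leq_addr.
Qed.

Lemma max_Lambda B n : (0 < B)%N -> (3 <= n)%N ->
  (\max_(F : {set {set 'I_n}} | kf_MLS F) Lambda B F)%N = Mstar B n.
Proof.
move=> B0 n3; apply/eqP; rewrite eqn_leq; apply/andP; split.
  by apply/bigmax_leqP => M HM; apply: Lambda_le_Mstar.
have n0 : (0 < n)%N by lia.
rewrite -(Lambda_flip (Ordinal n0) _ B0); last by lia.
by apply: (leq_bigmax_cond (F := Lambda B (n := n))); apply: flip_kf_MLS.
Qed.

Lemma in_maximizers B n (F : {set {set 'I_n}}) : (0 < B)%N -> (3 <= n)%N ->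
  (F \in maximizers B n) = kf_MLS F && (Lambda B F == Mstar B n).
Proof.
move=> B0 n3; rewrite inE; apply/andb_id2l => HF; apply/forallP/eqP => [H|E G].
  apply/eqP; rewrite eqn_leq Lambda_le_Mstar //=.
  have n0 : (0 < n)%N by lia.
  rewrite -(Lambda_flip (Ordinal n0) _ B0); last by lia.
  by apply: (implyP (H _)); apply: flip_kf_MLS.
by apply/implyP => HG; rewrite E Lambda_le_Mstar.
Qed.

Lemma gap_gt0 B n : (2 <= B)%N -> (5 <= n)%N -> (0 < gap B n)%N.
Proof. by move=> B2 n5; rewrite subn_gt0 ltn_exp2l //; lia. Qed.

(** The term [k = 2] of [Lambda_flip_sub] is isolated, its factor [B ^ (n - 2) - B ^ 2] being
    [gap B n]; [r] collects the other terms. Those with [k <= 1] are zero because both systems have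
    these layers empty. *)
Lemma Mstar_layer2 B n (M : {set {set 'I_n}}) (a : 'I_n) : (0 < B)%N -> (5 <= n)%N ->
  kf_MLS M -> exists2 r : nat,
    Mstar B n = (Lambda B M + (n - 1 - layer M 2) * gap B n + r)%N &
    (forall k, (3 <= k)%N -> (k.*2 < n)%N -> layer (flip a) k = layer M k) -> r = 0%N.
Proof.
move=> B0 n5 HM; have i2 : (2 < n.+1)%N by lia.
rewrite -(Lambda_flip a) //.
rewrite (Lambda_flip_sub a B0 _ HM); last by lia.
rewrite (bigD1 (Ordinal i2)) //=.
rewrite layer2_flip; last by lia.
eexists; first by rewrite addnA.
move=> H; apply: big1 => k /andP[kn k2]; have [k3|k3] := leqP 3 k.
  by rewrite H // subnn.
have : nat_of_ord k != 2 by apply: contraNneq k2 => E; apply/eqP/val_inj.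
move=> k22; have k1 : (k <= 1)%N by lia.
by rewrite !kf_MLS_layer_le1 // flip_kf_MLS //; lia.
Qed.

Lemma layer2_le n (M : {set {set 'I_n}}) : (5 <= n)%N -> kf_MLS M ->
  (layer M 2 <= n - 1)%N.
Proof.
move=> n5 HM; have n0 : (0 < n)%N by lia.
rewrite -(layer2_flip (Ordinal n0)); last by lia.
by apply: layer_le_flip => //; lia.
Qed.

(** Since [n - 1] is at least 4, the triangle alternative with its three pairs is excluded. *)
Lemma layer2_max n (M : {set {set 'I_n}}) : (5 <= n)%N -> kf_MLS M ->
  (layer M 2 = n - 1)%N <-> M \in one_flips n.
Proof.
move=> n5 HM; split => [M2|/imsetP[a _ ->]]; last by rewrite layer2_flip //; lia.
have L3 : (3 <= layer M 2)%N by lia.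
have [[a Ma]|[M3 _]] := kf_MLS_pairs HM L3; last by lia.
by apply/imsetP; exists a => //; apply: nbh_full => //; lia.
Qed.

(** For [c] distinct from [a] and [b], the pair [[set a; c]] is in [flip a]; in [flip b] it would
    have to be [[set~ b]], which has at least three points. *)
Lemma flip_inj n : (4 <= n)%N -> injective (@flip n).
Proof.
move=> n4 a b ab; apply/eqP; apply: contraT => nab.
have /card_gt0P[c] : (0 < #|~: [set a; b]|)%N.
  by rewrite card_ordC cards2 nab; lia.
rewrite !inE negb_or => /andP[ca cb].
have : [set a; c] \in flip a.
  rewrite in_flip !inE eqxx /=; apply: contraNneq ca => /setP/(_ c).
  by rewrite !inE eqxx orbT => /esym.
rewrite ab in_flip !inE eq_sym (negbTE nab) eq_sym (negbTE cb) /=.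
move=> /eqP/(congr1 (fun S => #|pred_of_set S|)).
by rewrite cards2 cardC1_ord eq_sym ca; lia.
Qed.

Lemma card_one_flips n : (4 <= n)%N -> #|one_flips n| = n.
Proof. by move=> n4; rewrite card_imset ?card_ord //; apply: flip_inj. Qed.

Lemma maximizers_ge5 B n : (2 <= B)%N -> (5 <= n)%N -> maximizers B n = one_flips n.
Proof.
move=> B2 n5; have B0 : (0 < B)%N by lia. have n3 : (3 <= n)%N by lia.
apply/setP => M; rewrite in_maximizers //; apply/andP/idP => [[HM /eqP ME]|].
  apply/(layer2_max n5 HM); have n0 : (0 < n)%N by lia.
  have [r] := Mstar_layer2 (Ordinal n0) B0 n5 HM.
  have := gap_gt0 B2 n5; have := layer2_le n5 HM.
  rewrite ME => l1 g0 E _.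
  have /eqP : ((n - 1 - layer M 2) * gap B n = 0)%N by move: E; move: (_ * _)%N; lia.
  by rewrite muln_eq0 => /orP[]; lia.
by move=> /imsetP[a _ ->]; rewrite flip_kf_MLS // Lambda_flip //; lia.
Qed.

Lemma second_bound B n (M : {set {set 'I_n}}) : (2 <= B)%N -> (5 <= n)%N ->
  kf_MLS M -> M \notin one_flips n -> (Lambda B M <= Mstar B n - gap B n)%N.
Proof.
move=> B2 n5 HM /negP nM; have B0 : (0 < B)%N by lia. have n0 : (0 < n)%N by lia.
have [r -> _] := Mstar_layer2 (Ordinal n0) B0 n5 HM.
have l1 := layer2_le n5 HM.
have : (0 < n - 1 - layer M 2)%N.
  rewrite lt0n; apply/eqP => E; apply: nM; apply/layer2_max => //; lia.
case: (n - 1 - layer M 2)%N => // m _; rewrite mulSn; lia.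
Qed.

Lemma second_extremal_of_layers B n (M : {set {set 'I_n}}) (a : 'I_n) :
  (2 <= B)%N -> (5 <= n)%N -> kf_MLS M -> layer M 2 = (n - 2)%N ->
  (forall k, (3 <= k)%N -> (k.*2 < n)%N -> layer (flip a) k = layer M k) ->
  M \in second_extremal B n.
Proof.
move=> B2 n5 HM M2 Mk; have B0 : (0 < B)%N by lia.
rewrite inE HM /=; apply/andP; split.
  by apply/negP => /(layer2_max n5 HM); lia.
have [r -> /(_ Mk) ->] := Mstar_layer2 a B0 n5 HM.
have -> : (n - 1 - layer M 2 = 1)%N by lia.
by rewrite mul1n addn0 addnK.
Qed.

Lemma U_pairs n (a : 'I_n) (D S : {set 'I_n}) : (3 <= #|D|)%N ->
  S \in U a D -> #|S| = 2 -> a \in S.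
Proof.
by move=> D3; rewrite in_U; case: ifP => // _ /subset_leq_card DS S2; lia.
Qed.

Lemma U_second_extremal B n (a : 'I_n) (D : {set 'I_n}) : (2 <= B)%N -> (5 <= n)%N ->
  D \subset [set~ a] -> #|D| = (n - 2)%N -> U a D \in second_extremal B n.
Proof.
move=> B2 n5 Da Dn; have HU : kf_MLS (U a D) by apply: U_kf_MLS => //; lia.
have aD : a \notin D by apply/negP => /(subsetP Da); rewrite !inE eqxx.
apply: (@second_extremal_of_layers _ _ _ a) => //.
  rewrite (@layer2_nbh _ _ a) => [|S SU S2]; last by apply: U_pairs SU S2; lia.
  rewrite -Dn; apply: eq_card => x; rewrite inE in_U !inE eqxx /=.
  apply/andP/idP => [[xa /set0Pn[y]]|xD].
    by rewrite !inE => /andP[/orP[]/eqP-> //]; rewrite (negbTE aD).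
  split; first by apply: contraNneq aD => <-.
  by apply/set0Pn; exists x; rewrite !inE eqxx orbT.
(* A set of size [k < n - 2] cannot contain [D], and one of size [k >= 3] cannot be disjoint from
   it, so these layers agree with those of the star at [a]. *)
move=> k k3 kn; rewrite layer_flip; [|lia|lia].
apply: eq_card => S; rewrite inE [RHS]inE in_U; apply: andb_id2r => /eqP Sk.
case: ifP => aS /=; last first.
  by apply/esym/negbTE/negP => /subset_leq_card; lia.
apply/esym/negP => /eqP SD.
have : (#|S :|: D| <= n)%N by rewrite -[leqRHS](card_ord n) max_card.
by rewrite cardsU SD cards0; lia.
Qed.

Lemma layer2_ball n (T : {set 'I_n}) : #|T| = 3 ->
  layer [set S : {set 'I_n} | 2 <= #|S :&: T|] 2 = 3.
Proof.
move=> T3; rewrite -[RHS]/('C(3, 2)) -T3 -cards_draws; apply: eq_card => S.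
rewrite !inE; apply: andb_id2r => /eqP S2.
apply/idP/idP => [H|/setIidPl ->]; last by rewrite S2.
by apply/setIidPl/eqP; rewrite eqEcard subsetIl S2.
Qed.

(** The three pairs of the ball are exactly [n - 2] for [n = 5], and no [k >= 3] satisfies
    [k.*2 < 5]. *)
Lemma ball_second_extremal B (T : {set 'I_5}) : (2 <= B)%N -> #|T| = 3 ->
  Defs.ball T \in second_extremal B 5.
Proof.
move=> B2 T3; apply: (@second_extremal_of_layers _ _ _ ord0) => //.
- exact: ball_kf_MLS.
- exact: layer2_ball.
- by move=> k; lia.
Qed.

Lemma second_extremalE B n (M : {set {set 'I_n}}) : (2 <= B)%N -> (5 <= n)%N ->
  M \in second_extremal B n -> M \in U_systems n \/
  (n = 5 /\ exists2 C : {set 'I_n}, #|C| = 3 & M = [set S : {set 'I_n} | 2 <= #|S :&: C|]).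
Proof.
move=> B2 n5; rewrite inE => /and3P[HM nM /eqP ME]; have B0 : (0 < B)%N by lia.
have n0 : (0 < n)%N by lia.
have M2 : layer M 2 = (n - 2)%N.
  have [r E _] := Mstar_layer2 (Ordinal n0) B0 n5 HM.
  have g0 := gap_gt0 B2 n5; have l1 := layer2_le n5 HM.
  have : (n - 1 - layer M 2)%N != 0%N.
    by apply/eqP => l0; move/negP: nM; apply; apply/(layer2_max n5 HM); lia.
  (* A deficit of two or more pairs would cost at least two positive gaps, but only one is
     available. *)
  move: E; rewrite ME; case E1: (n - 1 - layer M 2)%N => [|[|m]] //; first by lia.
  by rewrite !mulSn; move: (m * gap B n)%N; lia.
have L3 : (3 <= layer M 2)%N by lia.
have [[a Ma]|[M3 HC]] := kf_MLS_pairs HM L3; last by right; split=> //; lia.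
left; rewrite inE; apply/existsP; exists a; apply/existsP; exists (nbh M a).
by rewrite nbh_sub -Ma M2 eqxx /= -eq_U_nbh //; lia.
Qed.

Lemma U_systems_second_extremal B n (M : {set {set 'I_n}}) : (2 <= B)%N -> (5 <= n)%N ->
  M \in U_systems n -> M \in second_extremal B n.
Proof.
move=> B2 n5; rewrite inE => /existsP[a /existsP[D /and3P[Da /eqP Dn /eqP ->]]].
exact: U_second_extremal.
Qed.

Lemma second_extremal_ge6 B n : (2 <= B)%N -> (6 <= n)%N -> second_extremal B n = U_systems n.
Proof.
move=> B2 n6; have n5 : (5 <= n)%N by lia.
apply/setP => M; apply/idP/idP; last exact: U_systems_second_extremal.
by case/(second_extremalE B2 n5) => // -[n5' _]; lia.
Qed.

Lemma second_extremal5 B : (2 <= B)%N -> second_extremal B 5 = U_systems 5 :|: balls.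
Proof.
move=> B2; apply/setP => M; rewrite in_setU; apply/idP/orP.
  case/second_extremalE => // [->|[_ [C C3 ->]]]; [by left|right].
  by apply/imsetP; exists C => //; rewrite inE C3.
case; first exact: U_systems_second_extremal.
by case/imsetP => T; rewrite inE => /eqP T3 ->; apply: ball_second_extremal.
Qed.

(** All pairs in [U a D] pass through [a], while the three pairs inside [T] have no common point. *)
Lemma U_neq_ball n (a : 'I_n) (D T : {set 'I_n}) : (3 <= #|D|)%N -> #|T| = 3 ->
  U a D <> [set S : {set 'I_n} | 2 <= #|S :&: T|].
Proof.
move=> D3 T3 E; have aT x : x \in T -> a \in T :\ x.
  move=> xT; have Tx2 : #|T :\ x| = 2 by have := cardsD1 x T; rewrite xT T3; lia.
  apply: (U_pairs D3 _ Tx2); rewrite E inE.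
  have Txs : T :\ x \subset T by apply: subsetDl.
  by rewrite (setIidPl Txs) Tx2.
have /card_gt0P[x xT] : (0 < #|T|)%N by rewrite T3.
by have := aT x xT; rewrite !inE => /andP[_ /aT]; rewrite !inE eqxx.
Qed.

Lemma ball_inj n (T T' : {set 'I_n}) : #|T| = 3 -> #|T'| = 3 ->
  [set S : {set 'I_n} | 2 <= #|S :&: T|] = [set S : {set 'I_n} | 2 <= #|S :&: T'|] -> T = T'.
Proof.
move=> T3 T'3 E; apply/eqP; rewrite eqEcard T3 T'3 leqnn andbT; apply/subsetP => x xT.
have /card_gt0P[y] : (0 < #|T :\ x|)%N by have := cardsD1 x T; rewrite xT T3; lia.
rewrite !inE => /andP[yx yT].
have : [set x; y] \in [set S : {set 'I_n} | 2 <= #|S :&: T|].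
  rewrite inE; have /setIidPl -> : [set x; y] \subset T.
    by apply/subsetP => z; rewrite !inE => /orP[]/eqP->.
  by rewrite cards2 eq_sym yx.
rewrite E inE => H; have : [set x; y] :&: T' == [set x; y].
  by rewrite eqEcard subsetIl cards2 (leq_trans _ H) //; case: (x != y).
by move=> /eqP/setP/(_ x); rewrite !inE eqxx /=.
Qed.

Lemma card_balls : #|balls| = 10.
Proof.
rewrite card_in_imset => [|T T']; last by rewrite !inE => /eqP T3 /eqP T'3; apply: ball_inj.
rewrite -[RHS]/('C(5, 3)) -[5 in RHS](card_ord 5) -card_draws.
by apply: eq_card => T; rewrite !inE.
Qed.

Lemma U_systems_balls_disjoint : [disjoint U_systems 5 & balls].
Proof.
rewrite disjoint_subset; apply/subsetP => M; rewrite inE.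
move=> /existsP[a /existsP[D /and3P[Da /eqP Dn /eqP ->]]].
rewrite inE; apply/negP => /imsetP[T]; rewrite inE => /eqP T3.
by apply: U_neq_ball => //; rewrite Dn.
Qed.

(** * Ground sets of four and three points *)

Lemma triangleE (C : {set 'I_4}) : #|C| = 3 ->
  triangle C = [set S : {set 'I_4} | 2 <= #|S :&: C|].
Proof.
move=> C3; apply/setP => S; rewrite !inE.
have S4 : (#|S| <= 4)%N by rewrite -[leqRHS](card_ord 4) max_card.
have SC : (#|S :\: C| <= 1)%N.
  have := subset_leq_card (subsetDr S C); have := card_ordC C; rewrite C3 => ->; apply.
have E := cardsID C S.
have S1 : (S == [set: 'I_4]) = (#|S| == 4).
  by rewrite eqEcard subsetT cardsT card_ord eqn_leq S4.
rewrite S1 -setD_eq0 -cards_eq0; move: E SC S4.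
move: (#|S|) (#|S :&: C|) (#|S :\: C|) => s i d; lia.
Qed.

Lemma card_triangles : #|triangles| = 4.
Proof.
rewrite card_in_imset => [|T T']; last first.
  by rewrite !inE => /eqP T3 /eqP T'3; rewrite !triangleE //; apply: ball_inj.
rewrite -[RHS]/('C(4, 3)) -[4 in RHS](card_ord 4) -card_draws.
by apply: eq_card => T; rewrite !inE.
Qed.

(** The six 2-sets form three complementary pairs, and [M] takes one set from each. *)
Lemma kf_MLS4_layer2 (M : {set {set 'I_4}}) : kf_MLS M -> layer M 2 = 3.
Proof.
move=> /andP[HM _]; have := @layer_setC 4 M 2 isT isT HM.
by rewrite card_draws card_ord -[X in _ = X]/6 -[(4 - 2)%N]/2; lia.
Qed.

(** For [n <= 4] the condition [k.*2 < n] leaves only [k <= 1], where all layers are empty, so there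
    is no deficit. *)
Lemma kf_MLS_small_Lambda B n (M : {set {set 'I_n}}) : (0 < B)%N -> (3 <= n <= 4)%N ->
  kf_MLS M -> Lambda B M = Mstar B n.
Proof.
move=> B0 /andP[n3 n4] HM; have n0 : (0 < n)%N by lia.
rewrite -(Lambda_flip (Ordinal n0)) //; last by lia.
rewrite (Lambda_flip_sub (Ordinal n0) B0 n3 HM) big1 ?addn0 // => k kn.
by rewrite !kf_MLS_layer_le1 // ?flip_kf_MLS //; lia.
Qed.

Lemma maximizers4 B : (0 < B)%N -> maximizers B 4 = one_flips 4 :|: triangles.
Proof.
move=> B0; apply/setP => M; rewrite in_maximizers // in_setU; apply/andP/orP.
  case=> HM _; have M3 := kf_MLS4_layer2 HM.
  have [|[a Ma]|[_ [C C3 ->]]] := kf_MLS_pairs HM; first by rewrite M3.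
    by left; apply/imsetP; exists a => //; apply: nbh_full; rewrite // -Ma M3.
  by right; rewrite -triangleE //; apply/imsetP; exists C => //; rewrite inE C3.
move=> H; suff HM : kf_MLS M by split=> //; rewrite kf_MLS_small_Lambda.
case: H => /imsetP[x xP ->]; first exact: flip_kf_MLS.
by rewrite inE in xP; rewrite triangleE ?ball_kf_MLS //; apply/eqP.
Qed.

Lemma one_flips_triangles_disjoint : [disjoint one_flips 4 & triangles].
Proof.
rewrite disjoint_subset; apply/subsetP => _ /imsetP[a _ ->]; rewrite inE.
apply/negP => /imsetP[T]; rewrite inE => /eqP T3; rewrite triangleE // flipE.
by apply: U_neq_ball; rewrite // cardC1_ord.
Qed.

Lemma kf_MLS4_profile (M : {set {set 'I_4}}) : kf_MLS M ->
  [seq layer M k | k <- iota 0 5] = [:: 0; 0; 3; 4; 1].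
Proof.
move=> HM; have M2 := kf_MLS4_layer2 HM.
have M0 := kf_MLS_layer_le1 HM (leq0n 1); have M1 := kf_MLS_layer_le1 HM (leqnn 1).
have /andP[HM1 _] := HM.
have M4 : layer M 4 = 1%N.
  by have := @layer_setC 4 M 0 isT isT HM1; rewrite card_draws card_ord M0.
have M3 : layer M 3 = 4%N.
  by have := @layer_setC 4 M 1 isT isT HM1; rewrite card_draws card_ord M1.
by rewrite /= M0 M1 M2 M3 M4.
Qed.

(** Every 2-set is the complement of a singleton, and singletons are excluded. *)
Lemma kf_MLS3_unique (M : {set {set 'I_3}}) : kf_MLS M ->
  M = [set S : {set 'I_3} | 2 <= #|S :&: [set: 'I_3]|].
Proof.
move=> HM; have /andP[HM1 _] := HM; apply: MLS_eq_ball => //.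
  by rewrite cardsT card_ord.
move=> S _ S2; rewrite -(setCK S) MLS_setC //.
have /cards1P[x ->] : #|~: S| == 1%N by rewrite card_ordC S2.
exact: kf_MLS_set1.
Qed.

Lemma flip3 (a b : 'I_3) : flip a = flip b.
Proof. by rewrite (kf_MLS3_unique (flip_kf_MLS a _)) // (kf_MLS3_unique (flip_kf_MLS b _)). Qed.

Lemma maximizers3 B : (0 < B)%N -> maximizers B 3 = one_flips 3.
Proof.
move=> B0; apply/setP => M; rewrite in_maximizers //; apply/andP/imsetP.
  case=> HM _; exists ord0 => //.
  by rewrite (kf_MLS3_unique HM) (kf_MLS3_unique (flip_kf_MLS ord0 _)).
by case=> a _ ->; rewrite flip_kf_MLS // Lambda_flip.
Qed.

(** * Counting maximal linked systems *)

(** Truth tables of the monotone Boolean functions of [m] variables, in the order of [truth_table]: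
    the halves are the restrictions to first variable false and true, both monotone and the first
    pointwise below the second. *)
Fixpoint monotone_tables (m : nat) : seq (seq bool) :=
  if m is m'.+1 then
    [seq p.1 ++ p.2 | p <- [seq (f, g) | f <- monotone_tables m', g <- monotone_tables m']
                    & all2 implb p.1 p.2]
  else [:: [:: false]; [:: true]].

Fixpoint truth_table (m : nat) (f : seq bool -> bool) : seq bool :=
  if m is m'.+1 then
    truth_table m' (fun s => f (false :: s)) ++ truth_table m' (fun s => f (true :: s))
  else [:: f [::]].

Definition monotone_fun m (f : seq bool -> bool) :=
  forall s t, size s = m -> size t = m -> all2 implb s t -> f s -> f t.

Lemma size_truth_table m f : size (truth_table m f) = 2 ^ m.
Proof.
by elim: m f => // m IH f; rewrite /= size_cat !IH expnS mul2n addnn.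
Qed.

Lemma truth_table_inj m f g : truth_table m f = truth_table m g ->
  forall s, size s = m -> f s = g s.
Proof.
elim: m f g => [|m IH] f g /=; first by move=> [fg] [].
move=> /eqP; rewrite eqseq_cat ?size_truth_table // => /andP[/eqP E0 /eqP E1].
by move=> [|[] s] //= [sm]; [exact: (IH _ _ E1)|exact: (IH _ _ E0)].
Qed.

Lemma truth_table_le m (f g : seq bool -> bool) : (forall s, size s = m -> f s -> g s) ->
  all2 implb (truth_table m f) (truth_table m g).
Proof.
elim: m f g => [|m IH] f g H /=; first by rewrite andbT; apply/implyP/H.
have Hb b s : size s = m -> f (b :: s) -> g (b :: s).
  by move=> sm; apply: H; rewrite /= sm.
have := IH _ _ (Hb false); have := IH _ _ (Hb true).
rewrite !all2E !size_cat !size_truth_table !eqxx /= => H1 H0.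
by rewrite zip_cat ?size_truth_table // all_cat H0 H1.
Qed.

Lemma all2_implb_refl s : all2 implb s s.
Proof. by elim: s => // -[]. Qed.

Lemma truth_table_monotone m f : monotone_fun m f -> truth_table m f \in monotone_tables m.
Proof.
elim: m f => [|m IH] f H; first by rewrite /= !inE; case: (f [::]).
have mf b : monotone_fun m (fun s => f (b :: s)).
  by move=> s t sm tm st; apply: H; rewrite /= ?sm ?tm //; case: b.
apply/mapP; exists (truth_table m (fun s => f (false :: s)),
                    truth_table m (fun s => f (true :: s))) => //.
rewrite mem_filter; apply/andP; split.
  by apply: truth_table_le => s sm; apply: H; rewrite /= ?sm ?all2_implb_refl.
by apply/allpairsP; eexists (_, _); split; [exact: IH (mf false)|exact: IH (mf true)|].
Qed.

Lemma size_monotone_tablesS m :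
  size (monotone_tables m.+1) <= size (monotone_tables m) ^ 2.
Proof.
by rewrite /= size_map size_filter (leq_trans (count_size _ _)) // size_allpairs.
Qed.

Lemma size_monotone_tables4 : size (monotone_tables 4) = 168.
Proof. by vm_compute. Qed.

(** The bound squares with each further variable. Starting from the 20 functions of three variables
    would put 400 in place of 168, above the 256 that the gap can absorb for [B = 2]. *)
Lemma size_monotone_tables j : size (monotone_tables (4 + j)) <= 168 ^ (2 ^ j).
Proof.
elim: j => [|j IH]; first by rewrite size_monotone_tables4.
rewrite addnS (leq_trans (size_monotone_tablesS _)) // (expnSr 2 j) expnM.
by rewrite leq_sqr.
Qed.

(* For s of size n - 1 the default value puts the last point in the set. *)
Definition set_of_bits n (s : seq bool) : {set 'I_n} := [set i : 'I_n | nth true s i].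

Lemma set_of_bits_onto m (S : {set 'I_m.+1}) : ord_max \in S ->
  exists2 s, size s = m & S = set_of_bits m.+1 s.
Proof.
move=> mS; exists [seq (inord i : 'I_m.+1) \in S | i <- iota 0 m].
  by rewrite size_map size_iota.
apply/setP => i; rewrite inE; have [im|mi] := ltnP i m.
  by rewrite (nth_map 0%N) ?size_iota // nth_iota // add0n inord_val.
rewrite nth_default ?size_map ?size_iota //.
by have -> : i = ord_max by apply: val_inj => /=; have := ltn_ord i; lia.
Qed.

(** By complementation [M] is determined by its members containing the last point; as [M] is an
    up-set, these form a monotone function of the other [m] points. *)
Lemma card_MLS m : #|[set M : {set {set 'I_m.+1}} | MLS M]| <= size (monotone_tables m).
Proof.
pose phi (M : {set {set 'I_m.+1}}) := truth_table m (fun s => set_of_bits m.+1 s \in M).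
have inj : {in [set M | MLS M] &, injective phi}.
  move=> M N; rewrite !inE => HM HN /truth_table_inj E.
  have EM (S : {set 'I_m.+1}) : ord_max \in S -> (S \in M) = (S \in N).
    by case/set_of_bits_onto => s sm ->; apply: E.
  apply/setP => S; have [mS|mS] := boolP (ord_max \in S); first by rewrite (EM S mS).
  rewrite -[S]setCK (@MLS_setC _ M (~: S)) // (@MLS_setC _ N (~: S)) //.
  congr (~~ _); apply: EM.
  by rewrite inE.
rewrite cardE -(size_map phi); apply: uniq_leq_size.
  by rewrite map_inj_in_uniq ?enum_uniq // => M N; rewrite !mem_enum; apply: inj.
move=> _ /mapP[M HM ->]; move: HM; rewrite mem_enum inE => HM; apply: truth_table_monotone.
move=> s t sm tm st sM; apply: MLS_up HM sM _; apply/subsetP => i; rewrite !inE.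
have [im|mi] := ltnP i m; last by rewrite !nth_default ?sm ?tm.
move=> si; have := st; rewrite all2E => /andP[_ /(all_nthP (true, true)) /(_ i)].
by rewrite size_zip sm tm minnn nth_zip ?sm ?tm // => /(_ im) /implyP; apply.
Qed.

Lemma card_MLS_bound n : (5 <= n)%N ->
  (#|[set M : {set {set 'I_n}} | MLS M]| <= 168 ^ (2 ^ (n - 5)))%N.
Proof.
case: n => // m m4; apply: leq_trans (card_MLS m) _.
have -> : m = (4 + (m.+1 - 5))%N by lia.
have -> : ((4 + (m.+1 - 5)).+1 - 5 = m.+1 - 5)%N by lia.
exact: size_monotone_tables.
Qed.

(** * Kernel-free and kernel-bearing families *)

Lemma sum_cover_le (X I : finType) (W : X -> nat) (P : I -> pred X) (J : pred I) (T : pred X) :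
  (forall F, T F -> exists2 a, J a & P a F) ->
  (\sum_(F | T F) W F <= \sum_(a | J a) \sum_(F | P a F) W F)%N.
Proof.
move=> HT; under [leqRHS]eq_bigr do rewrite big_mkcond.
rewrite big_mkcond exchange_big; apply: leq_sum => F _ /=.
case: ifP => // /HT[a Ja PF]; rewrite (bigD1 a) //= PF; exact: leq_addr.
Qed.

(** A Bonferroni inequality with slack: [Q a b] may exceed the overlap of [P a] and [P b], and [T]
    is only required on the part of [P a] outside every [Q a b]. *)
Lemma le_sum_cover (X I : finType) (W : X -> nat) (P : I -> pred X)
  (Q : I -> I -> pred X) (T : pred X) :
  (forall a F, P a F -> (forall b, b != a -> ~~ Q a b F) -> T F) ->
  (forall a b F, b != a -> P a F -> P b F -> Q a b F) ->
  (\sum_a \sum_(F | P a F) W F <=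
   \sum_(F | T F) W F + \sum_a \sum_(b | b != a) \sum_(F | Q a b F) W F)%N.
Proof.
move=> HT HQ; under eq_bigr do rewrite big_mkcond.
rewrite exchange_big [X in (_ <= X + _)%N]big_mkcond.
under [X in (_ <= _ + X)%N]eq_bigr => a _.
  under eq_bigr do rewrite big_mkcond.
  rewrite exchange_big; over.
rewrite [X in (_ <= _ + X)%N]exchange_big -big_split; apply: leq_sum => F _ /=.
(* If some [P a] holds at [F] without any [Q a b], then [F] is counted once on the left and [T F]
   holds. Otherwise each [P a] holding at [F] is paid for by some [Q a b]. *)
have [/existsP[a /andP[Pa /forallP Na]]|Ex] :=
    boolP [exists a, P a F && [forall b, (b != a) ==> ~~ Q a b F]].
  have {}Na b : b != a -> ~~ Q a b F by apply/implyP.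
  rewrite (bigD1 a) //= Pa (HT a F Pa Na) big1 ?addn0 ?leq_addr // => b ba.
  by case: ifP => // Pb; have := Na b ba; rewrite (HQ a b F ba Pa Pb).
apply: leq_trans (leq_addl _ _); apply: leq_sum => a _; case: ifP => // Pa.
move: Ex; rewrite negb_exists => /forallP/(_ a); rewrite Pa negb_forall.
move=> /existsP[b]; rewrite negb_imply negbK => /andP[ba Qab].
by rewrite (bigD1 b) //= Qab leq_addr.
Qed.

Lemma star_of_kernel n (F : {set {set 'I_n}}) : intersecting F && ~~ kernel_free F ->
  exists2 a, true & F \subset Star a.
Proof.
case/andP => HF /set0Pn[a /bigcapP aF]; exists a => //.
apply/subsetP => S SF; rewrite !inE aF // andbT.
by case/andP: HF => /subsetP/(_ S SF); rewrite inE.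
Qed.

Lemma Star_kernel n (a : 'I_n) (F : {set {set 'I_n}}) : F \subset Star a ->
  intersecting F && ~~ kernel_free F.
Proof.
move=> /subsetP Fa; have aF S : S \in F -> a \in S by move=> /Fa; rewrite inE => /andP[].
apply/andP; split.
  by apply/intersectingP => S T SF TF; apply/set0Pn; exists a; rewrite inE !aF.
by apply/set0Pn; exists a; apply/bigcapP => S /aF.
Qed.

Lemma Lambda_Star2 B n (a b : 'I_n) : b != a ->
  Lambda B (Star a :&: Star b) = ((B + 1) ^ (n - 2))%N.
Proof.
move=> ba; have := sum_supersets B [set a; b]; rewrite cards2 eq_sym ba => <-.
apply: eq_bigl => S; rewrite !inE subUset !sub1set.
case: (eqVneq S set0) => [->|_]; rewrite ?inE //=.
Qed.

Lemma Zcap_le B n : (0 < B)%N -> (Zcap B n <= n * B ^ ((B + 1) ^ (n - 1)))%N.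
Proof.
move=> B0; apply: leq_trans (sum_cover_le _ (@star_of_kernel n)) _.
under eq_bigr => a _ do rewrite sum_prod_w // Lambda_Star.
by rewrite sum_nat_const card_ord.
Qed.

Lemma sum_pairs_le n (c : 'I_n -> 'I_n -> nat) m : (forall a b, b != a -> c a b <= m) ->
  (\sum_a \sum_(b | b != a) c a b <= n * n * m)%N.
Proof.
move=> H; rewrite -mulnA -[X in (_ <= X * _)%N](card_ord n) -sum_nat_const.
apply: leq_sum => a _; rewrite -[X in (_ <= X * _)%N](card_ord n) -sum_nat_const.
rewrite big_mkcond; apply: leq_sum => b _; case: ifP => // /H //.
Qed.

Lemma Zcap_ge B n : (0 < B)%N ->
  (n * B ^ ((B + 1) ^ (n - 1)) <= Zcap B n + n * n * B ^ ((B + 1) ^ (n - 2)))%N.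
Proof.
move=> B0.
have := @le_sum_cover _ _ (fun F : {set {set 'I_n}} => \prod_(S in F) w B S)%N
  (fun a F => F \subset Star a) (fun a b F => F \subset Star a :&: Star b)
  (fun F => intersecting F && ~~ kernel_free F).
move=> H; have -> : (n * B ^ ((B + 1) ^ (n - 1)) =
    \sum_(a : 'I_n) \sum_(F : {set {set 'I_n}} | F \subset Star a) \prod_(S in F) w B S)%N.
  under eq_bigr => a _ do rewrite sum_prod_w // Lambda_Star.
  by rewrite sum_nat_const card_ord.
apply: leq_trans (H _ _) _.
- by move=> a F /Star_kernel.
- by move=> a b F _ Fa Fb; rewrite subsetI Fa Fb.
rewrite leq_add2l; apply: sum_pairs_le => a b ba.
by rewrite sum_prod_w // Lambda_Star2.
Qed.

Lemma setC1_in_flip n (a : 'I_n) : [set~ a] \in flip a.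
Proof. by rewrite in_flip ifN ?eqxx // !inE eqxx. Qed.

(** Families omitting [[set~ a]] are the subfamilies of [flip a :\ [set~ a]], whose [Lambda] is
    smaller by [B]. This is the origin of the factor $1-B^{-B}$. *)
Lemma sum_flip_kernel_free B n (a : 'I_n) : (0 < B)%N -> (2 <= n)%N ->
  (\sum_(F : {set {set 'I_n}} | (F \subset flip a) && ([set~ a] \in F)) \prod_(S in F) w B S
   + B ^ (Mstar B n - B) = B ^ Mstar B n)%N.
Proof.
move=> B0 n2; rewrite -[in RHS](Lambda_flip a) // -sum_prod_w //.
rewrite [RHS](bigID (fun F : {set {set 'I_n}} => [set~ a] \in F)) /=; congr (_ + _)%N.
have -> : (Mstar B n - B)%N = Lambda B (flip a :\ [set~ a]).
  rewrite -(Lambda_flip a) // {1}/Lambda (big_setD1 _ (setC1_in_flip a)) /=.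
  by rewrite cardC1_ord subKn ?expn1 ?addKn //; lia.
rewrite -sum_prod_w //; apply: eq_bigl => F.
by rewrite subsetD1.
Qed.

Lemma sum_flips_kernel_free B n : (0 < B)%N -> (2 <= n)%N ->
  (n * B ^ Mstar B n = \sum_(a : 'I_n) \sum_(F : {set {set 'I_n}} |
      (F \subset flip a) && ([set~ a] \in F)) \prod_(S in F) w B S
    + n * B ^ (Mstar B n - B))%N.
Proof.
move=> B0 n2; transitivity (\sum_(a : 'I_n) B ^ Mstar B n)%N.
  by rewrite sum_nat_const card_ord.
under eq_bigr => a _ do rewrite -(sum_flip_kernel_free a) //.
by rewrite big_split /= sum_nat_const card_ord.
Qed.

Lemma flip_of_kernel_free n (a : 'I_n) (F : {set {set 'I_n}}) : F \subset flip a ->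
  kernel_free F -> [set~ a] \in F.
Proof.
move=> /subsetP Fa /kernel_freeP/(_ a)[S SF aS].
by have := Fa S SF; rewrite in_flip (negbTE aS) => /eqP <-.
Qed.

(** Families inside some one-flip star are bounded by the union bound. Any other extends to an MLS,
    still kernel-free and not a one-flip star, to which [second_bound] applies. The extra summand on
    the left avoids a truncated subtraction. *)
Lemma Rfree_le B n : (2 <= B)%N -> (5 <= n)%N ->
  (Rfree B n + n * B ^ (Mstar B n - B) <=
   n * B ^ Mstar B n + 168 ^ (2 ^ (n - 5)) * B ^ (Mstar B n - gap B n))%N.
Proof.
move=> B2 n5; have B0 : (0 < B)%N by lia.
rewrite /Rfree (bigID (fun F : {set {set 'I_n}} => [exists a, F \subset flip a])) /=.
rewrite addnAC; apply: leq_add.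
  rewrite sum_flips_kernel_free //; last by lia.
  rewrite leq_add2r; apply: sum_cover_le => F /andP[/andP[_ HF] /existsP[a Fa]].
  by exists a => //; rewrite Fa flip_of_kernel_free.
apply: leq_trans (_ : \sum_(M : {set {set 'I_n}} | kf_MLS M && (M \notin one_flips n))
    \sum_(F : {set {set 'I_n}} | F \subset M) \prod_(S in F) w B S <= _)%N.
  apply: sum_cover_le => F /andP[/andP[HF kF]]; rewrite negb_exists => /forallP nF.
  have [M HM FM] := maxset_exists HF; exists M => //.
  rewrite /kf_MLS /MLS HM (kernel_free_sub FM kF) /=.
  by apply/imsetP => -[a _ ME]; have := nF a; rewrite -ME FM.
apply: (@leq_trans (\sum_(M : {set {set 'I_n}} | kf_MLS M && (M \notin one_flips n))
   B ^ (Mstar B n - gap B n))%N).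
  apply: leq_sum => M /andP[HM nM]; rewrite sum_prod_w //.
  by apply: leq_pexp2l => //; apply: second_bound.
rewrite sum_nat_const leq_mul2r; apply/orP; right.
apply: leq_trans (card_MLS_bound n5); apply: subset_leq_card.
by apply/subsetP => M; rewrite unfold_in /= inE => /andP[/andP[]].
Qed.

(** Contains both the overlap of [flip a] and [flip b] and every member of [flip a] that passes
    through [b]. *)
Definition flip_meet n (a b : 'I_n) : {set {set 'I_n}} :=
  (Star a :&: Star b) :|: [set [set~ a]] :|: [set [set~ b]].

Lemma Lambda_flip_meet B n (a b : 'I_n) : b != a -> (2 <= n)%N ->
  (Lambda B (flip_meet a b) <= (B + 1) ^ (n - 2) + 2 * B)%N.
Proof.
have Lset1 (c : 'I_n) : (2 <= n)%N -> Lambda B [set [set~ c]] = B.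
  by move=> n2; rewrite /Lambda big_set1 cardC1_ord subKn ?expn1 //; lia.
have LU (F G : {set {set 'I_n}}) : (Lambda B (F :|: G) <= Lambda B F + Lambda B G)%N.
  rewrite /Lambda.
  rewrite (big_mkcond (mem (F :|: G))) (big_mkcond (mem F)) (big_mkcond (mem G)) -big_split.
  by apply: leq_sum => S _; rewrite /= !inE; case: (S \in F); case: (S \in G); rewrite /= ?leq_addr.
move=> ba n2; rewrite -(Lambda_Star2 B ba); apply: leq_trans (LU _ _) _.
by rewrite Lset1 // mul2n -addnn addnA leq_add2r; apply: leq_trans (LU _ _) _; rewrite Lset1.
Qed.

(** A subfamily of [flip a] not inside [flip_meet a b] has a member missing [b]. If this holds for
    all [b != a] and [[set~ a]] is present, the family is kernel-free, so [le_sum_cover] applies. *)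
Lemma Rfree_ge B n : (2 <= B)%N -> (3 <= n)%N ->
  (n * B ^ Mstar B n <= Rfree B n + n * B ^ (Mstar B n - B)
     + n * n * B ^ ((B + 1) ^ (n - 2) + 2 * B))%N.
Proof.
move=> B2 n3; have B0 : (0 < B)%N by lia.
rewrite [leqLHS]sum_flips_kernel_free //; last by lia.
rewrite addnAC leq_add2r.
have := @le_sum_cover _ _ (fun F : {set {set 'I_n}} => \prod_(S in F) w B S)%N
  (fun a F => (F \subset flip a) && ([set~ a] \in F)) (fun a b F => F \subset flip_meet a b)
  (fun F => intersecting F && kernel_free F).
move=> H; apply: leq_trans (H _ _) _.
- move=> a F /andP[Fa aF] nQ; apply/andP; split.
    have /andP[/MLS_intersecting HI _] := flip_kf_MLS a n3.
    exact: intersecting_sub Fa HI.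
  apply/kernel_freeP => b; have [->|ba] := eqVneq b a.
    by exists [set~ a] => //; rewrite !inE eqxx.
  have /subsetPn[S SF SQ] := nQ b ba; exists S => //; apply: contra SQ => bS.
  have := subsetP Fa S SF; rewrite in_flip; case: ifP => aS.
    rewrite !inE aS bS !andbT => _; apply/orP; left; apply/orP; left; rewrite andbb.
    by apply/set0Pn; exists a.
  by move=> /eqP ->; rewrite /flip_meet !in_setU !in_set1 eqxx orbT.
- move=> a b F ba /andP[/subsetP Fa _] /andP[/subsetP Fb _]; apply/subsetP => S SF.
  have := Fa S SF; have := Fb S SF; rewrite !in_flip !inE.
  case: ifP => bS; case: ifP => aS; rewrite ?andbF ?andbT ?orbF.
  + by move=> _ _; apply/orP; left; apply/orP; left; rewrite andbb; apply/set0Pn; exists a.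
  + by move=> _ ->; rewrite ?orbT.
  + by move=> ->; rewrite ?orbT.
  + by move=> ->; rewrite ?orbT.
rewrite leq_add2l; apply: sum_pairs_le => a b ba; rewrite sum_prod_w //.
by apply: leq_pexp2l => //; apply: Lambda_flip_meet => //; lia.
Qed.

End Combinatorics.

(** * Asymptotics *)

Local Open Scope ring_scope.

Section Asymptotics.
Set Implicit Arguments.
Unset Strict Implicit.

Lemma expnS_ge B m : (0 < B)%N -> (B ^ m + m <= (B + 1) ^ m)%N.
Proof.
move=> B0; elim: m => // m IH.
have Bm : (0 < B ^ m)%N by rewrite expn_gt0 B0.
rewrite !expnS; apply: leq_trans (_ : (B + 1) * (B ^ m + m) <= _)%N; last by rewrite leq_mul2l IH orbT.
rewrite mulnDl mul1n mulnDr; move: Bm; move: (B ^ m)%N (B * B ^ m)%N (B * m)%N; lia.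
Qed.

(** With $x=(B+1)^{n-2}$ and $y=B^{n-2}$ one has $(B+1)^{n-1}-B^{n-1}=x+B(x-y)$, and $x-y\ge n-2$ by
    [expnS_ge]. *)
Lemma Mstar_ge B n : (2 <= B)%N -> (2 <= n)%N ->
  ((B + 1) ^ (n - 2) + 2 * (n - 2) <= Mstar B n)%N.
Proof.
move=> B2 n2; have E : (n - 1 = (n - 2).+1)%N by lia.
have H : (B * (B ^ (n - 2) + (n - 2)) <= B * (B + 1) ^ (n - 2))%N.
  by rewrite leq_mul2l expnS_ge ?orbT //; lia.
have : (2 * (n - 2) <= B * (n - 2))%N by rewrite leq_mul2r B2 orbT.
move: H; rewrite /Mstar E !expnS mulnDl mul1n mulnDr.
set x := ((B + 1) ^ (n - 2))%N; set y := (B ^ (n - 2))%N.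
by move: x (B * x)%N (B * y)%N (B * (n - 2))%N; lia.
Qed.

Lemma expn_succ_ge B n : (2 <= B)%N -> (2 <= n)%N ->
  ((B + 1) ^ (n - 2) + 2 * (n - 2) <= (B + 1) ^ (n - 1))%N.
Proof.
move=> B2 n2; apply: leq_trans (Mstar_ge B2 n2) _.
have : (B ^ 1 <= B ^ (n - 1))%N by rewrite leq_pexp2l; lia.
have : (B ^ (n - 1) <= (B + 1) ^ (n - 1))%N by rewrite leq_exp2r; lia.
by rewrite /Mstar expn1; move: ((B + 1) ^ _)%N (B ^ _)%N; lia.
Qed.

(** The slack in the exponent is worth at least $4^{n-2}=2^n\cdot 2^n/16$: one factor $2^n$ absorbs
    $n$, the other gives geometric decay. *)
Lemma tail_bound B n e E : (2 <= B)%N -> (3 <= n)%N -> (e + 2 * (n - 2) <= E)%N ->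
  (n * 2 ^ n * B ^ e <= 16 * B ^ E)%N.
Proof.
move=> B2 n3 eE; have B0 : (0 < B)%N by lia.
apply: leq_trans (_ : 16 * B ^ (e + 2 * (n - 2)) <= _)%N; last first.
  by rewrite leq_mul2l leq_pexp2l.
rewrite expnD mulnA [leqRHS]mulnAC leq_mul2r; apply/orP; right.
apply: leq_trans (_ : 16 * 2 ^ (2 * (n - 2)) <= _)%N; last first.
  by rewrite leq_mul2l /= leq_exp2r // ; lia.
rewrite -[16%N]/(2 ^ 4)%N -expnD; have -> : (4 + 2 * (n - 2) = n + n)%N by lia.
by rewrite expnD leq_mul2r; apply/orP; right; apply/ltnW/ltn_expl.
Qed.

Lemma Mstar_gapE B n : (2 <= B)%N -> (5 <= n)%N -> (gap B n <= Mstar B n)%N.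
Proof.
move=> B2 n5; apply: leq_trans (_ : B ^ (n - 2) <= _)%N; first exact: leq_subr.
apply: leq_trans (Mstar_ge B2 _); last by lia.
apply: leq_trans (leq_addr _ _); rewrite leq_exp2r //; lia.
Qed.

(** Here $168=256\cdot 21/32$, and $256^{2^{n-5}}=2^{2^{n-2}}\le B^{B^{n-2}}$, whose exponent is
    [B ^ 2 + gap B n]. The power of $21/32$ is weakened from $2^{n-5}$ to $n-5$. *)
Lemma pow168_bound (R : realType) B n : (2 <= B)%N -> (5 <= n)%N ->
  (168 ^ (2 ^ (n - 5)))%:R <=
  (B ^ (B ^ 2))%:R * (21 / 32) ^+ (n - 5) * (B ^ gap B n)%:R :> R.
Proof.
move=> B2 n5; set j := (n - 5)%N.
have q0 : 0 <= 21 / 32 :> R by lra.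
have q1 : 21 / 32 <= 1 :> R by lra.
have H1 : (256 ^ (2 ^ j) <= B ^ (B ^ 2) * B ^ gap B n)%N.
  rewrite -expnD; have -> : (B ^ 2 + gap B n = B ^ (n - 2))%N.
    by rewrite subnKC // leq_pexp2l //; lia.
  rewrite -[256%N]/(2 ^ 8)%N -expnM; apply: leq_trans (_ : 2 ^ (B ^ (n - 2)) <= _)%N.
    rewrite leq_exp2l // -[8%N]/(2 ^ 3)%N -expnD.
    have -> : (3 + j = n - 2)%N by lia.
    by rewrite leq_exp2r //; lia.
  by rewrite leq_exp2r // expn_gt0; lia.
rewrite natrX; have -> : 168%:R = 256%:R * (21 / 32) :> R by lra.
rewrite exprMn -natrX mulrAC; apply: ler_pM.
- exact: ler0n.
- by rewrite exprn_ge0.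
- by rewrite -natrM ler_nat.
- by apply: ler_wiXn2l => //; apply/ltnW/ltn_expl.
Qed.

Lemma Rfree_ratio_le (R : realType) B n : (2 <= B)%N -> (5 <= n)%N ->
  (Rfree B n)%:R / (n%:R * B%:R ^+ Mstar B n) <=
  1 - B%:R ^- B + (B ^ (B ^ 2))%:R * (32 / 21) ^+ 5 * (21 / 32) ^+ n :> R.
Proof.
move=> B2 n5; have b0 : 0 < B%:R :> R by rewrite ltr0n; lia.
have N1 : 1 <= n%:R :> R by rewrite ler1n; lia.
have X0 : 0 < B%:R ^+ Mstar B n :> R by rewrite exprn_gt0.
rewrite ler_pdivrMr; last by rewrite mulr_gt0 //; lra.
have := Rfree_le B2 n5; rewrite -(ler_nat R) !natrD !natrM.
have MB : (B <= Mstar B n)%N by exact: leq_addl.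
have y : (B ^ (Mstar B n - B))%:R = B%:R ^- B * B%:R ^+ Mstar B n :> R.
  by rewrite natrX -{2}(subnK MB) exprD mulrCA mulVf ?mulr1 // expf_neq0 // gt_eqF.
have z : (B ^ (Mstar B n - gap B n))%:R * (B ^ gap B n)%:R = B%:R ^+ Mstar B n :> R.
  by rewrite -natrM -expnD subnK ?natrX // Mstar_gapE.
(* The constant $(32/21)^5$ undoes the shift by 5, so that the error term is a constant times an
   [n]-th power. *)
have q5 : (32 / 21) ^+ 5 * (21 / 32) ^+ n = (21 / 32) ^+ (n - 5) :> R.
  rewrite -{1}(subnK n5) exprD mulrCA -exprMn.
  have -> : 32 / 21 * (21 / 32) = 1 :> R by lra.
  by rewrite expr1n mulr1.
have KE : (B ^ (B ^ 2))%:R * (32 / 21) ^+ 5 * (21 / 32) ^+ n =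
    (B ^ (B ^ 2))%:R * (21 / 32) ^+ (n - 5) :> R by rewrite -mulrA q5.
have := @pow168_bound R B n B2 n5; rewrite KE.
have : 0 <= (B ^ (B ^ 2))%:R * (21 / 32) ^+ (n - 5) :> R.
  by rewrite mulr_ge0 ?exprn_ge0 //; lra.
move: ((B ^ (B ^ 2))%:R * _) => K K0 T.
have : (168 ^ (2 ^ (n - 5)))%:R * (B ^ (Mstar B n - gap B n))%:R
    <= K * (n%:R * B%:R ^+ Mstar B n).
  apply: le_trans (ler_wpM2r (ler0n _ _) T) _.
  rewrite -mulrA (mulrC _%:R) z ler_wpM2l // ler_peMl // ltW //.
rewrite y (natrX _ B (Mstar B n)) !mulrDl mulNr mul1r => TX.
move: (B%:R ^- B) (B%:R ^+ Mstar B n) TX => ib X; lra.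
Qed.

(** The factor [B%:R ^+ (2 * B)] comes from the two sets that [flip_meet] adds to the overlap of two
    stars. *)
Lemma Rfree_ratio_ge (R : realType) B n : (2 <= B)%N -> (5 <= n)%N ->
  1 - B%:R ^- B - 16 * B%:R ^+ (2 * B) * (1 / 2) ^+ n <=
  (Rfree B n)%:R / (n%:R * B%:R ^+ Mstar B n) :> R.
Proof.
move=> B2 n5; have b0 : 0 < B%:R :> R by rewrite ltr0n; lia.
have n3 : (3 <= n)%N by lia.
have N0 : 0 < n%:R :> R by rewrite ltr0n; lia.
have X0 : 0 < B%:R ^+ Mstar B n :> R by rewrite exprn_gt0.
rewrite ler_pdivlMr; last by rewrite mulr_gt0.
have := Rfree_ge B2 n3; rewrite -(ler_nat R) !natrD !natrM.
have MB : (B <= Mstar B n)%N by exact: leq_addl.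
have -> : (B ^ (Mstar B n - B))%:R = B%:R ^- B * B%:R ^+ Mstar B n :> R.
  by rewrite natrX -{2}(subnK MB) exprD mulrCA mulVf ?mulr1 // expf_neq0 // gt_eqF.
have := tail_bound B2 n3 (Mstar_ge B2 (ltnW n3)).
rewrite -(ler_nat R) !natrM !natrX exprD => T.
have {}T : n%:R * B%:R ^+ ((B + 1) ^ (n - 2)) <= 16 * (1 / 2) ^+ n * B%:R ^+ Mstar B n :> R.
  have h0 : 0 < (1 / 2) ^+ n :> R by rewrite exprn_gt0 //; lra.
  rewrite -mulrA mulrCA -ler_pdivrMl //.
  rewrite -exprVn; have -> : (1 / 2)^-1 = 2 :> R by lra.
  by rewrite mulrA (mulrC (2 ^+ n)).
have := ler_wpM2l (ltW N0) (ler_wpM2r (exprn_ge0 (2 * B) (ltW b0)) T).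
rewrite !mulrDl !mulNr; lra.
Qed.

Lemma Zcap_ratio_ge (R : realType) B n : (2 <= B)%N -> (5 <= n)%N ->
  1 - 16 * (1 / 2) ^+ n <= (Zcap B n)%:R / (n%:R * B%:R ^+ ((B + 1) ^ (n - 1))) :> R.
Proof.
move=> B2 n5; have b0 : 0 < B%:R :> R by rewrite ltr0n; lia.
have n3 : (3 <= n)%N by lia.
have N0 : 0 < n%:R :> R by rewrite ltr0n; lia.
rewrite ler_pdivlMr; last by rewrite mulr_gt0 // exprn_gt0.
have := @Zcap_ge B n (ltnW B2); rewrite -(ler_nat R) !natrD !natrM.
have := tail_bound B2 n3 (expn_succ_ge B2 (ltnW n3)).
rewrite -(ler_nat R) !natrM !natrX => T.
have {}T : n%:R * B%:R ^+ ((B + 1) ^ (n - 2)) <=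
    16 * (1 / 2) ^+ n * B%:R ^+ ((B + 1) ^ (n - 1)) :> R.
  have h0 : 0 < (1 / 2) ^+ n :> R by rewrite exprn_gt0 //; lra.
  rewrite -mulrA mulrCA -ler_pdivrMl //.
  rewrite -exprVn; have -> : (1 / 2)^-1 = 2 :> R by lra.
  by rewrite mulrA (mulrC (2 ^+ n)).
have := ler_wpM2l (ltW N0) T.
rewrite !mulrDl !mulNr; lra.
Qed.

Lemma Zcap_ratio_le (R : realType) B n : (2 <= B)%N -> (5 <= n)%N ->
  (Zcap B n)%:R / (n%:R * B%:R ^+ ((B + 1) ^ (n - 1))) <= 1 :> R.
Proof.
move=> B2 n5; have b0 : 0 < B%:R :> R by rewrite ltr0n; lia.
have N1 : 1 <= n%:R :> R by rewrite ler1n; lia.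
rewrite ler_pdivrMr ?mul1r; last by rewrite mulr_gt0 ?exprn_gt0 //; lra.
by rewrite -natrX -natrM ler_nat Zcap_le //; lia.
Qed.

(** * Limits of the normalised sums *)

Lemma geometric_perturbation_cvg (R : realType) (l K q : R) : 0 <= q < 1 ->
  (l + K * q ^+ n @[n --> \oo] --> l)%classic.
Proof.
move=> /andP[q0 q1]; rewrite -[X in (_ --> X)%classic]addr0 -[X in l + X](mulr0 K).
apply: cvgD; first exact: cvg_cst.
apply: cvgM; first exact: cvg_cst.
by apply: cvg_expr; rewrite ger0_norm.
Qed.

Lemma Rfree_ratio_cvg (R : realType) B : (2 <= B)%N ->
  ((Rfree B n)%:R / (n%:R * B%:R ^+ Mstar B n) @[n --> \oo] --> (1 - B%:R ^- B : R))%classic.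
Proof.
move=> B2; apply: squeeze_cvgr.
- near=> n; apply/andP; split; last by apply: Rfree_ratio_le B2 _; near: n; exact: nbhs_infty_ge.
  have := @Rfree_ratio_ge R B n B2; rewrite -mulNr; apply.
  by near: n; exact: nbhs_infty_ge.
- by apply: geometric_perturbation_cvg; lra.
- by apply: geometric_perturbation_cvg; lra.
Unshelve. all: by end_near. Qed.

Lemma Zcap_ratio_cvg (R : realType) B : (2 <= B)%N ->
  ((Zcap B n)%:R / (n%:R * B%:R ^+ ((B + 1) ^ (n - 1))) @[n --> \oo] --> (1 : R))%classic.
Proof.
move=> B2; apply: squeeze_cvgr.
- near=> n; apply/andP; split; last by apply: Zcap_ratio_le B2 _; near: n; exact: nbhs_infty_ge.
  have := @Zcap_ratio_ge R B n B2; rewrite -mulNr; apply.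
  by near: n; exact: nbhs_infty_ge.
- by apply: geometric_perturbation_cvg; lra.
- exact: cvg_cst.
Unshelve. all: by end_near. Qed.

Lemma one_sub_pow_gt0 (R : realType) B : (2 <= B)%N -> 0 < 1 - B%:R ^- B :> R.
Proof.
move=> B2; rewrite subr_gt0 invf_lt1; last by rewrite exprn_gt0 // ltr0n; lia.
by rewrite exprn_egt1 ?ltr1n //; lia.
Qed.

Lemma Rfree_asymptotics (R : realType) (B : nat) : (2 <= B)%N ->
  exists2 eps : nat -> R,
    (eps n @[n --> \oo] --> (0 : R))%classic &
    (\forall n \near \oo,
       (Rfree B n)%:R =
         (1 - B%:R ^- B + eps n) * n%:R * B%:R ^+ Mstar B n)%classic.
Proof.
move=> B2; pose c : R := 1 - B%:R ^- B.
exists (fun n => (Rfree B n)%:R / (n%:R * B%:R ^+ Mstar B n) - c).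
  rewrite -(subrr c); apply: cvgB; [exact: Rfree_ratio_cvg|exact: cvg_cst].
near=> n; have n1 : (1 <= n)%N by near: n; exact: nbhs_infty_ge.
rewrite -/c addrC subrK -mulrA divfK // mulf_neq0 // ?expf_neq0 ?pnatr_eq0; lia.
Unshelve. all: by end_near. Qed.

Lemma Zcap_Rfree_asymptotics (R : realType) (B : nat) : (2 <= B)%N ->
  exists2 eps : nat -> R,
    (eps n @[n --> \oo] --> (0 : R))%classic &
    (\forall n \near \oo,
       logb (B%:R : R) ((Zcap B n)%:R / (Rfree B n)%:R) =
         B%:R ^+ (n - 1) - B%:R
         + logb B%:R (B%:R ^+ B / (B%:R ^+ B - 1)) + eps n)%classic.
Proof.
move=> B2; have b1 : 1 < B%:R :> R by rewrite ltr1n.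
have b0 : 0 < B%:R :> R by lra.
have lnb : 0 < ln (B%:R : R) by rewrite ln_gt0.
have c0 := one_sub_pow_gt0 R B2.
have bB1 : 1 < B%:R ^+ B :> R by rewrite exprn_egt1 //; lia.
have cE : (B%:R ^+ B / (B%:R ^+ B - 1)) = (1 - B%:R ^- B)^-1 :> R.
  move: bB1; move: (B%:R ^+ B) => x x1.
  by field; rewrite ?subr_eq0 ?gt_eqF //; lra.
set c : R := 1 - B%:R ^- B in c0 cE.
pose r n : R := (Rfree B n)%:R / (n%:R * B%:R ^+ Mstar B n).
pose z n : R := (Zcap B n)%:R / (n%:R * B%:R ^+ ((B + 1) ^ (n - 1))).
have rc : (r n @[n --> \oo] --> c)%classic by exact: Rfree_ratio_cvg.
have zc : (z n @[n --> \oo] --> (1 : R))%classic by exact: Zcap_ratio_cvg.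
have zr : (z n / r n @[n --> \oo] --> c^-1)%classic.
  rewrite -[X in (_ --> X)%classic]mul1r; apply: cvgM => //.
  by apply: cvgV => //; rewrite gt_eqF.
(* The ratio of the normalised sums tends to [c^-1], which by [cE] is the constant inside the
   logarithm. *)
exists (fun n => logb (B%:R : R) (z n / r n) - logb B%:R c^-1).
  rewrite -(subrr (logb (B%:R : R) c^-1)); apply: cvgB; last exact: cvg_cst.
  apply: cvgMr_tmp; apply: (cvg_comp _ _ zr); apply: continuous_ln.
  by rewrite invr_gt0.
near=> n.
have n2 : (2 <= n)%N by near: n; exact: nbhs_infty_ge.
have r0 : 0 < r n by near: n; exact: (cvgr_gt c rc).
have z0 : 0 < z n by near: n; apply: (cvgr_gt 1 zc).
have N0 : n%:R != 0 :> R by rewrite pnatr_eq0; lia.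
have Bn : (B <= B ^ (n - 1))%N by rewrite -{1}(expn1 B) leq_pexp2l; lia.
have -> : (Zcap B n)%:R / (Rfree B n)%:R = z n / r n * B%:R ^+ (B ^ (n - 1) - B) :> R.
  (* The difference of the exponents of the two normalisations is the leading term of the
     logarithm. *)
  have E : ((B + 1) ^ (n - 1) = Mstar B n + (B ^ (n - 1) - B))%N.
    have : (B ^ (n - 1) <= (B + 1) ^ (n - 1))%N by rewrite leq_exp2r; lia.
    by rewrite /Mstar; lia.
  have R0 : (Rfree B n)%:R != 0 :> R.
    by apply: contraTneq r0; rewrite /r => ->; rewrite mul0r ltxx.
  rewrite /z /r E exprD; field.
  by rewrite ?N0 ?R0 ?expf_neq0 // gt_eqF.
have zr0 : 0 < z n / r n by rewrite divr_gt0.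
rewrite cE /logb (@lnM _ (z n / r n)) ?posrE ?exprn_gt0 // lnXn // -[ln _ *+ _]mulr_natr natrB // natrX.
by field; rewrite gt_eqF.
Unshelve. all: by end_near. Qed.

End Asymptotics.

Theorem theorem5p11 (R : realType) (B : nat) (hB : (2 <= B)%N) :
  (* (i) *)
  [/\ forall n : nat, (3 <= n)%N ->
        (\max_(F : {set {set 'I_n}} | kf_MLS F) Lambda B F)%N = Mstar B n,
      forall n : nat, (5 <= n)%N ->
        maximizers B n = one_flips n /\ #|one_flips n| = n,
      [/\ maximizers B 4 = one_flips 4 :|: triangles,
          #|one_flips 4| = 4%N, #|triangles| = 4%N, #|maximizers B 4| = 8%N
        & forall F : {set {set 'I_4}}, F \in maximizers B 4 ->
            [seq layer F k | k <- iota 0 5] = [:: 0; 0; 3; 4; 1]%N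
            /\ Lambda B F = (3 * B ^ 2 + 4 * B + 1)%N
            /\ (3 * B ^ 2 + 4 * B + 1)%N = Mstar B 4],
      maximizers B 3 = one_flips 3 /\ (forall a b : 'I_3, flip a = flip b)
    & forall n : nat, (3 <= n)%N ->
        Mstar 2 n = (3 ^ (n - 1) - 2 ^ (n - 1) + 2)%N]
  /\
  (* (ii) *)
  [/\ forall n : nat, (5 <= n)%N ->
        forall M : {set {set 'I_n}}, kf_MLS M -> M \notin one_flips n ->
          (Lambda B M <= Mstar B n - gap B n)%N,
      forall n : nat, (6 <= n)%N -> second_extremal B n = U_systems n,
      [/\ second_extremal B 5 = U_systems 5 :|: balls,
          [disjoint U_systems 5 & balls] & #|balls| = 10%N],
      forall (n B' : nat), (5 <= n)%N -> (2 <= B')%N ->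
        second_extremal B n = second_extremal B' n
    & forall n : nat, (5 <= n)%N -> gap 2 n = (2 ^ (n - 2) - 4)%N]
  /\
  (* (iii) *)
  [/\ exists2 eps : nat -> R,
        (eps n @[n --> \oo] --> (0 : R))%classic &
        (\forall n \near \oo,
           (Rfree B n)%:R =
             (1 - B%:R ^- B + eps n) * n%:R * B%:R ^+ Mstar B n)%classic,
      exists2 eps : nat -> R,
        (eps n @[n --> \oo] --> (0 : R))%classic &
        (\forall n \near \oo,
           logb (B%:R : R) ((Zcap B n)%:R / (Rfree B n)%:R) =
             B%:R ^+ (n - 1) - B%:R
             + logb B%:R (B%:R ^+ B / (B%:R ^+ B - 1)) + eps n)%classic,
      1 - 2 ^- 2 = 3 / 4 :> R
    & logb (2 : R) (2 ^+ 2 / (2 ^+ 2 - 1)) = logb 2 (4 / 3)].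
Proof.
have B0 : (0 < B)%N by exact: ltnW.
split; [split|split; split].
- by move=> n n3; apply: max_Lambda.
- by move=> n n5; rewrite maximizers_ge5 // card_one_flips //; apply: ltnW.
- split.
  + exact: maximizers4.
  + exact: card_one_flips.
  + exact: card_triangles.
  + rewrite maximizers4 //.
    (* Disjointness is the equality case of this bound, so the sizes 4 and 4 add up to 8. *)
    have := leq_card_setU (one_flips 4) triangles.
    by move=> /leqifP; rewrite one_flips_triangles_disjoint card_one_flips // card_triangles => /eqP.
  move=> F; rewrite in_maximizers // => /andP[HF /eqP ->].
  have E : (3 * B ^ 2 + 4 * B + 1)%N = Mstar B 4.
    rewrite /Mstar (_ : (4 - 1 = 3)%N) //.
    have -> : ((B + 1) ^ 3 = B ^ 3 + (3 * B ^ 2 + 3 * B + 1))%N by rewrite !expnS !expn0; ring.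
    by rewrite addKn; ring.
  by rewrite kf_MLS4_profile // E.
- by split; [exact: maximizers3|exact: flip3].
- by [].
- by move=> n n5 M HM nM; apply: second_bound.
- by move=> n n6; apply: second_extremal_ge6.
- by split; [exact: second_extremal5|exact: U_systems_balls_disjoint|exact: card_balls].
- move=> n B' n5 B'2; move: n5; rewrite leq_eqVlt => /predU1P[<-|n6].
    by rewrite !second_extremal5.
  by rewrite !second_extremal_ge6.
- by move=> n n5.
- exact: Rfree_asymptotics.
- exact: Zcap_Rfree_asymptotics.
- by lra.
- have -> : 2 ^+ 2 - 1 = 3 :> R by lra.
  by have -> : 2 ^+ 2 = 4 :> R by lra.
Qed.
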